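(* Let $T>0$, let $g\colon\mathbb{R}^2\to\mathbb{R}^2$ be of class $C^2$, let $f\colon\mathbb{R}\times\mathbb{R}^2\to\mathbb{R}^2$ be of class $C^1$ and $T$-periodic in its first variable, and let $p_0\in\mathbb{R}^2$ be an isolated zero of $g$ with nonzero index $\mathrm{i}(g,p_0)\neq0$. Then $p_0$ is an ejecting point for the set of $T$-pairs of $$\dot x=g(x)+\lambda f(t,x),\qquad\lambda\in[0,\infty),$$ if there exists $v\in\ker g'(p_0)$ such that $$\int_0^Te^{(T-s)g'(p_0)}g''(p_0)[v,v]\,ds\neq0.$$ If, in particular, $\ker g'(p_0)=\mathbb{R}^2$, it is sufficient to find $v\in\mathbb{R}^2$ such that $g''(p_0)[v,v]\neq0$.
   Context: $C_T(\mathbb{R}^2)$ is the space of continuous $T$-periodic maps $\mathbb{R}\to\mathbb{R}^2$ with the metric of uniform convergence. A pair $(\lambda,x)\in[0,\infty)\times C_T(\mathbb{R}^2)$ is a $T$-pair if $x$ is a solution of $\dot x=g(x)+\lambda f(t,x)$ for that value of $\lambda$. Let $Y$ be a metric space, $X\subseteq[0,\infty)\times Y$, and $X_0=\{y\in Y:(0,y)\in X\}$ (identified with $\{0\}\times X_0\subseteq X$). A set $A\subseteq X_0$ is an ejecting set for $X$ if it is relatively open in $X_0$ and there exists a connected subset of $X$ which meets $A$ (i.e. meets $\{0\}\times A$) and is not contained in $X_0$ (i.e. in $\{0\}\times X_0$). A point $p$ is an ejecting point for $X$ if $\{p\}$ is an ejecting set. Here $X$ is the set of $T$-pairs, $Y=C_T(\mathbb{R}^2)$,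 and a point $p_0\in\mathbb{R}^2$ is identified with the constant function $\hat p_0\equiv p_0$ in $C_T(\mathbb{R}^2)$. The index $\mathrm{i}(g,p_0)$ of an isolated zero is the degree $\deg(g,U)$ of the vector field $g$ (Brouwer degree with respect to $0$) on any isolating open neighborhood $U$ of $p_0$. $g'(p_0)$ is the derivative of $g$ at $p_0$ and $g''(p_0)[\cdot,\cdot]$ is its second derivative, a symmetric bilinear map $\mathbb{R}^2\times\mathbb{R}^2\to\mathbb{R}^2$. *)

(* Defs.v *)
From HB Require Import structures.
From mathcomp Require Import all_boot all_order all_algebra.
From mathcomp Require Import all_classical all_reals all_analysis.
Import Order.TTheory GRing.Theory Num.Theory.
Import numFieldNormedType.Exports.

Set Implicit Arguments.
Unset Strict Implicit.
Unset Printing Implicit Defensive.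

Local Open Scope classical_set_scope.
Local Open Scope ring_scope.

(* Continuity of the derivative is expressed pointwise on vectors; when [V] is
   finite-dimensional, as in all uses below, this is the same as continuity of
   [p |-> 'd F p] for the operator norm. *)
Definition C1 (R : realType) (V W : normedModType R) (F : V -> W) : Prop :=
  (forall p, differentiable F p) /\
  (forall v, continuous (fun p => 'd F p v)).

Definition C2 (R : realType) (V W : normedModType R) (F : V -> W) : Prop :=
  C1 F /\ forall v, C1 (fun p => 'd F p v).

(* [second_diff F p u v] is F''(p)[u, v]. *)
Definition second_diff (R : realType) (V W : normedModType R)
    (F : V -> W) (p u v : V) : W :=
  'd (fun q => 'd F q u) p v.

(* Vectors are rows: ['d F p w = w *m 'J F p], and e^(F'(p)) sends [w] to
   [w *m expmx ('J F p)]. *)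
Definition expmx (R : realType) (n : nat) (A : 'M[R]_n.+1) : 'M[R]_n.+1 :=
  lim (series (fun k : nat => (k`!%:R)^-1 *: A ^+ k) @ \oo).

Definition vec_integral (R : realType) (n : nat) (a b : R)
    (F : R -> 'rV[R]_n) : 'rV[R]_n :=
  \row_i (\int[lebesgue_measure]_(s in `[a, b]) (F s 0 i)).

Section BrouwerDegree.
Variables (R : realType) (n : nat).
Implicit Types (F h : 'rV[R]_n.+1 -> 'rV[R]_n.+1) (U : set 'rV[R]_n.+1).

Definition boundary U : set 'rV[R]_n.+1 := closure U `\` U°.

(* [h] is C^1, has 0 as a regular value on [U], and is closer to [F] on the
   closure of [U] than the distance from 0 to the image of the boundary. *)
Definition regular_approx F U h : Prop :=
  [/\ C1 h,
      forall x, U x -> h x = 0 -> \det ('J h x) != 0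
    & exists e : R,
        (forall x, closure U x -> `|h x - F x| <= e) /\
        (forall x, boundary U x -> e < `|F x|)].

(* Brouwer degree with respect to 0, for [U] open and bounded and [F]
   continuous without zeros on the boundary of [U]. The value of the sum does
   not depend on [h]; the sum is finite because the zeros of [h] in [U] are
   isolated and none lies on the boundary. *)
Definition degree F U : int :=
  xget 0 [set d : int | exists2 h, regular_approx F U h &
    d = \sum_(x \in [set x | U x /\ h x = 0]) sgz (\det ('J h x))].

Definition isolating_nbhd F p U : Prop :=
  [/\ open U, bounded_set U, U p & forall x, closure U x -> F x = 0 -> x = p].

Definition isolated_zero F p : Prop :=
  F p = 0 /\ \forall x \near p, F x = 0 -> x = p.

(* The value does not depend on [U], by excision. *)
Definition zero_index F p : int :=
  xget 0 [set d : int | exists2 U, isolating_nbhd F p U & d = degree F U].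

End BrouwerDegree.

Section Ejecting.
Variables (R : realType) (Y : topologicalType) (X : set (R * Y)).

Definition slice0 : set Y := [set y | X (0, y)].

Definition ejecting_set (A : set Y) : Prop :=
  [/\ A `<=` slice0,
      exists2 O : set Y, open O & A = slice0 `&` O
    & exists C : set (R * Y),
        [/\ connected C, C `<=` X, C `&` ([set 0] `*` A) !=set0
          & ~ (C `<=` [set 0] `*` slice0)]].

Definition ejecting_point (p : Y) : Prop := ejecting_set [set p].

End Ejecting.

Section TPairs.
Variables (R : realType) (T : R).

Definition CT_set : set {uniform R -> 'rV[R]_2} :=
  [set x | continuous (x : R -> 'rV[R]_2) /\ periodic (x : R -> 'rV[R]_2) T].

(* C_T(R^2); a set coerced to a type carries the topology induced from the
   ambient space, here that of uniform convergence on R. *)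
Definition CT : topologicalType := CT_set.

Lemma cst_CT_set (p : 'rV[R]_2) :
  CT_set ((fun=> p) : {uniform R -> 'rV[R]_2}).
Proof. by split; [exact: cst_continuous | move=> ?]. Qed.

Definition CT_cst (p : 'rV[R]_2) : CT :=
  exist (fun x => x \in CT_set) _ (mem_set (cst_CT_set p)).

Definition CT_fun (x : CT) : R -> 'rV[R]_2 := set_val x.

Definition Tpairs (g : 'rV[R]_2 -> 'rV[R]_2)
    (f : R -> 'rV[R]_2 -> 'rV[R]_2) : set (R * CT) :=
  [set z | 0 <= z.1 /\
    forall t : R, is_derive t 1 (CT_fun z.2)
      (g (CT_fun z.2 t) + z.1 *: f t (CT_fun z.2 t))].

End TPairs.

(* Main.v *)
Require Import Defs.
From HB Require Import structures.
From mathcomp Require Import all_boot all_order all_algebra.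
From mathcomp Require Import all_classical all_reals all_analysis.
From mathcomp Require Import ring lra.
Import Order.TTheory GRing.Theory Num.Theory.
Import numFieldNormedType.Exports.

Set Implicit Arguments.
Unset Strict Implicit.
Unset Printing Implicit Defensive.

Local Open Scope classical_set_scope.
Local Open Scope ring_scope.

(** A vector v as in the statement is nonzero, since g''(p0)[0, 0] = 0.  Hence
    A = g'(p0) is singular, and everything follows from this: the spectrum of a
    singular real 2x2 matrix is {0, tr A}, so that u' = u A has no nonconstant
    T-periodic solution.  The theorem is then the conjunction of two facts about
    a Lyapunov-Schmidt reduction.

    Reduction.  For every zero-mean T-periodic forcing e, the equation
    u' = u A + e has exactly one zero-mean T-periodic solution, with a bound
    (rv_periodic_solution, rv_periodic_bound).  Write the differential equation
    near p0 as x' = (x - p0) A + N(l, t, x), with N of small Lipschitz constant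
    in x (localized_forcing), and look for x = a + u with u of zero mean.  The
    contraction principle gives, for each parameter l and each mean value a, a
    unique u and a unique constant vector G(l, a) for which
    x' = (x - p0) A + N(l, t, x) - G(l, a) (lyapunov_schmidt).  So T-pairs near
    (0, p0) correspond to zeros of the finite-dimensional map G.  Constants solve
    the equation at l = 0, so uniqueness gives u = 0 there and G(0, a) = g(a)
    exactly.  The same uniqueness shows that p0 is isolated among the T-periodic
    solutions of x' = g(x), which is the relative openness of {p0}.

    Continuation.  The map G is continuous, and G(0, .) = g has nonzero index at
    p0.  If the quasi-component of (0, p0) in the compact set of zeros of G
    contained only (0, p0), an open set would separate this point from all zeros
    with l large, and homotopy invariance would make the index vanish.  The
    quasi-component is connected, so it is the required set, and x = a + u maps
    it continuously into the set of T-pairs (continuation, ejecting_of_singular).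

    The degree theory behind the last step is combinatorial.  The plane is cut
    into three sectors meeting only at 0, and a grid point is coloured by the
    sector that contains the value of the map.  The change of colour around a
    grid cell is a discrete winding number, the sum over the faces of a cube
    vanishes because each edge is run through in both directions, and a cell with
    nonzero winding is close to a zero.  Summation by parts over the cubes turns
    this into homotopy invariance (grid_degree_homotopy).  For linear maps the
    number is computed by deforming to a diagonal matrix (grid_degree_linear),
    and for maps with regular zeros it is the signed count of the zeros
    (grid_degree_count), so it detects the index (zero_index_grid_degree). *)

(** * Coloured grids: cells, cubes and discrete homotopy *)

(** The sign pattern (0 < y_0, 0 < y_1) of a vector y determines one of three
    sectors of the plane, numbered counterclockwise.  Three sectors are the
    fewest for which a closed walk can be seen to turn around 0. *)
Definition sector (b : bool * bool) : nat :=
  if b.1 then 0%N else if b.2 then 1%N else 2%N.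

Definition turn (a b : bool * bool) : int :=
  match sector a, sector b with
  | 0%N, 1%N | 1%N, 2%N | 2%N, 0%N => 1
  | 1%N, 0%N | 2%N, 1%N | 0%N, 2%N => -1
  | _, _ => 0
  end.

Lemma turnC a b : turn a b = - turn b a.
Proof. by case: a b => [[] []] [[] []]. Qed.

(** Three times the winding number of a closed walk through four sign patterns:
    a full turn crosses three sector boundaries. *)
Definition quad (a b c d : bool * bool) : int :=
  turn a b + turn b c + turn c d + turn d a.

(** A walk on which one coordinate keeps its sign stays in a half-plane, so it
    does not wind.  This and the next lemma are what ties a nonzero winding to a
    zero of both coordinates. *)
Lemma quad_constl (a b c d : bool * bool) :
  b.1 = a.1 -> c.1 = a.1 -> d.1 = a.1 -> quad a b c d = 0.
Proof.
by move: a b c d => [[] []] [[] []] [[] []] [[] []].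
Qed.

Lemma quad_constr (a b c d : bool * bool) :
  b.2 = a.2 -> c.2 = a.2 -> d.2 = a.2 -> quad a b c d = 0.
Proof.
by move: a b c d => [[] []] [[] []] [[] []] [[] []].
Qed.

(** For a map of the form (a(x), b(y)) the winding of a cell factors, and the
    sum over a grid telescopes in each direction. *)
Lemma quad_product (a a' b b' : bool) :
  quad (a, b) (a', b) (a', b') (a, b') =
  (a'%:R - a%:R) * (b'%:R - b%:R) * 3.
Proof. by case: a a' b b' => [] [] [] []. Qed.

Definition cell (s : nat -> nat -> bool * bool) (i j : nat) : int :=
  quad (s i j) (s i.+1 j) (s i.+1 j.+1) (s i j.+1).

(** The six faces of a cube form a closed surface: each edge is run through
    twice, in opposite directions. *)
Lemma cube_boundary (s0 s1 : nat -> nat -> bool * bool) i j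
  (fx := fun i j => quad (s0 i j) (s0 i j.+1) (s1 i j.+1) (s1 i j))
  (fy := fun i j => quad (s0 i j) (s0 i.+1 j) (s1 i.+1 j) (s1 i j)) :
  cell s1 i j - cell s0 i j =
  (fx i j - fx i.+1 j) + (fy i j.+1 - fy i j).
Proof.
rewrite /fx /fy /cell /quad.
rewrite [turn (s1 i j) (s0 i j)]turnC [turn (s1 i.+1 j) (s0 i.+1 j)]turnC.
rewrite [turn (s1 i j.+1) (s0 i j.+1)]turnC.
rewrite [turn (s1 i.+1 j) (s1 i j)]turnC [turn (s1 i j.+1) (s1 i j)]turnC.
rewrite [turn (s1 i.+1 j.+1) (s1 i.+1 j)]turnC.
rewrite [turn (s1 i.+1 j.+1) (s1 i j.+1)]turnC.
rewrite [turn (s0 i j.+1) (s0 i j)]turnC.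
rewrite [turn (s0 i.+1 j.+1) (s0 i j.+1)]turnC.
ring.
Qed.

(** Summation by parts when the weight only jumps where the summand vanishes. *)
Lemma weighted_telescope (chi E : nat -> int) n :
  chi 0%N = 0 -> chi n = 0 ->
  (forall i, (i < n)%N -> E i.+1 != 0 -> chi i = chi i.+1) ->
  \sum_(0 <= i < n) chi i * (E i.+1 - E i) = 0.
Proof.
move=> chi0 chin chiE.
rewrite (@eq_big_nat _ _ _ _ _ _ (fun i => chi i.+1 * E i.+1 - chi i * E i)).
  by rewrite (telescope_sumr (fun i => chi i * E i)) // chi0 chin; ring.
move=> i /andP[_ ilt].
by have [->|/chiE ->//] := eqVneq (E i.+1) 0; ring.
Qed.

(** Discrete homotopy invariance between two consecutive levels.  The weights
    chi select cells; they may change only across faces with zero winding, so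
    the sum of the cube relations reduces to the two horizontal levels. *)
Lemma slab_invariance (s0 s1 : nat -> nat -> bool * bool)
  (chi0 chi1 : nat -> nat -> int) n :
  (forall j, chi0 0%N j = 0) -> (forall j, chi0 n j = 0) ->
  (forall i, chi0 i 0%N = 0) -> (forall i, chi0 i n = 0) ->
  (forall i j, (i < n)%N -> (j < n)%N ->
     quad (s0 i.+1 j) (s0 i.+1 j.+1) (s1 i.+1 j.+1) (s1 i.+1 j) != 0 ->
     chi0 i j = chi0 i.+1 j) ->
  (forall i j, (i < n)%N -> (j < n)%N ->
     quad (s0 i j.+1) (s0 i.+1 j.+1) (s1 i.+1 j.+1) (s1 i j.+1) != 0 ->
     chi0 i j = chi0 i j.+1) ->
  (forall i j, (i < n)%N -> (j < n)%N -> cell s1 i j != 0 ->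
     chi0 i j = chi1 i j) ->
  \sum_(0 <= i < n) \sum_(0 <= j < n) chi0 i j * cell s0 i j =
  \sum_(0 <= i < n) \sum_(0 <= j < n) chi1 i j * cell s1 i j.
Proof.
move=> l r b t hx hy hz.
transitivity (\sum_(0 <= i < n) \sum_(0 <= j < n) chi0 i j * cell s1 i j).
  apply/esym/eqP; rewrite -subr_eq0 -sumrB.
  under eq_bigr do rewrite -sumrB.
  under eq_bigr do under eq_bigr do rewrite -mulrBr cube_boundary mulrDr.
  under eq_bigr do rewrite big_split.
  rewrite big_split /= exchange_big /= !big_nat !big1 ?addr0 //.
    move=> i /andP[_ ilt]; apply: weighted_telescope => // j jn; exact: hy.
  move=> j /andP[_ jlt].
  under eq_bigr do rewrite -opprB mulrN.
  rewrite sumrN; apply/eqP; rewrite oppr_eq0; apply/eqP.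
  by apply: (@weighted_telescope (chi0^~ j)
    (fun i => quad (s0 i j) (s0 i j.+1) (s1 i j.+1) (s1 i j))) => // i ilt /hx ->.
apply: eq_big_nat => i /andP[_ ilt]; apply: eq_big_nat => j /andP[_ jlt].
by have [->|/hz ->//] := eqVneq (cell s1 i j) 0; rewrite !mulr0.
Qed.

(** * From small cells to zeros of a planar map *)

(** Lebesgue's number lemma, for a property of sets that is inherited by
    subsets. *)
Lemma lebesgue_number (R : realType) (X : pseudoMetricType R) (K : set X)
    (P : set X -> Prop) :
  compact K -> (forall A B, A `<=` B -> P B -> P A) ->
  (forall z, K z -> exists2 W, nbhs z W & P W) ->
  exists2 e : R, 0 < e & forall z, K z -> P (ball z e).
Proof.
move=> /compact_near_coveringP cK Pmono Ploc.
have : \forall e \near (0:R)^'+, K `<=` (fun z => P (ball z e)).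
  apply: cK => z /Ploc[W /nbhs_ballP[r /= r0 rW] PW].
  near=> z' e => /=; apply: Pmono PW; apply: subset_trans rW.
  move=> y z'y; apply: (@ball_split _ _ z').
    by near: z'; apply: nbhsx_ballx; rewrite divr_gt0.
  by apply: le_ball z'y; near: e; apply: nbhs_right_le; rewrite divr_gt0.
move=> H; near (0:R)^'+ => e; exists e; first by [].
by near: e.
Unshelve. all: by end_near. Qed.

Definition signs (R : realType) (y : 'rV[R]_2) : bool * bool :=
  (0 < y 0 0, 0 < y 0 1).

Lemma signs_coord_near (R : realType) (X : topologicalType)
    (F : X -> 'rV[R]_2) (z : X) (i : 'I_2) :
  {for z, continuous F} -> F z 0 i != 0 ->
  \forall z' \near z, (0 < F z' 0 i) = (0 < F z 0 i).
Proof.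
move=> cF Fz.
have cFi : (fun y => F y 0 i) z' @[z' --> z] --> F z 0 i.
  apply: (@continuous_cvg _ _ _ _ _ F (fun y : 'rV[R]_2 => y 0 i)) => //.
  exact: coord_continuous.
have [F0|F0] := ltP 0 (F z 0 i).
  by near=> z'; near: z'; exact: cvgr_gt F0.
have {}F0 : F z 0 i < 0 by rewrite lt_neqAle Fz.
near=> z'; apply/negbTE; rewrite -leNgt ltW //; near: z'.
exact: cvgr_lt F0.
Unshelve. all: by end_near. Qed.

(** Near a point where F is nonzero, one coordinate of F keeps its sign and all
    small cells have zero winding.  Hence a relation Q only has to be checked
    near the zeros of F. *)
Lemma quad_near (R : realType) (X : topologicalType)
    (F : X -> 'rV[R]_2) (Q : X -> X -> Prop) (z : X) :
  {for z, continuous F} ->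
  (F z = 0 -> exists2 W, nbhs z W & forall x y, W x -> W y -> Q x y) ->
  exists2 W, nbhs z W & forall a b c d x y, W a -> W b -> W c -> W d ->
    W x -> W y ->
    quad (signs (F a)) (signs (F b)) (signs (F c)) (signs (F d)) != 0 ->
    Q x y.
Proof.
move=> cF FQ.
have [F0|F0] := eqVneq (F z 0 0) 0; last first.
  exists [set z' | (0 < F z' 0 0) = (0 < F z 0 0)]; first exact: signs_coord_near.
  move=> a b c d x y /= Wa Wb Wc Wd _ _.
  by rewrite quad_constl ?eqxx //= ?Wa ?Wb ?Wc ?Wd.
have [F1|F1] := eqVneq (F z 0 1) 0; last first.
  exists [set z' | (0 < F z' 0 1) = (0 < F z 0 1)]; first exact: signs_coord_near.
  move=> a b c d x y /= Wa Wb Wc Wd _ _.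
  by rewrite quad_constr ?eqxx //= ?Wa ?Wb ?Wc ?Wd.
have /FQ[W zW WQ] : F z = 0.
  by apply/rowP => -[[|[|//]] lt]; rewrite mxE; [rewrite -[RHS]F0|rewrite -[RHS]F1];
    congr (F z _ _); apply: val_inj.
by exists W => // a b c d x y *; exact: WQ.
Qed.

Lemma quad_uniform (R : realType) (X : pseudoMetricType R) (K : set X)
    (F : X -> 'rV[R]_2) (Q : X -> X -> Prop) :
  compact K -> continuous F ->
  (forall z, K z -> F z = 0 ->
    exists2 W, nbhs z W & forall x y, W x -> W y -> Q x y) ->
  exists2 e : R, 0 < e & forall z, K z -> forall a b c d x y,
    ball z e a -> ball z e b -> ball z e c -> ball z e d ->
    ball z e x -> ball z e y ->
    quad (signs (F a)) (signs (F b)) (signs (F c)) (signs (F d)) != 0 ->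
    Q x y.
Proof.
move=> cK cF FQ.
apply: (lebesgue_number (P := fun W => forall a b c d x y, W a -> W b -> W c -> W d ->
    W x -> W y ->
    quad (signs (F a)) (signs (F b)) (signs (F c)) (signs (F d)) != 0 ->
    Q x y)) => //.
- by move=> A B AB PB a b c d x y Aa Ab Ac Ad Ax Ay; apply: PB; exact: AB.
- by move=> z Kz; apply: quad_near (cF z) _ => /(FQ _ Kz).
Qed.

Definition grid (R : realType) (M : R) (n i : nat) : R :=
  - M + i%:R * (2 * M / n%:R).

Definition node (R : realType) (M : R) (n i j : nat) : 'rV[R]_2 :=
  \row_k (if k == 0 then grid M n i else grid M n j).

(** The cells are selected by their lower left corner.  The value is three times
    the degree of F on V when the grid is fine and F has no zero on the boundary
    of V. *)
Definition grid_degree (R : realType) (M : R) (n : nat)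
    (F : 'rV[R]_2 -> 'rV[R]_2) (V : set 'rV[R]_2) : int :=
  \sum_(0 <= i < n) \sum_(0 <= j < n)
    (`[< V (node M n i j) >])%:R * cell (fun i j => signs (F (node M n i j))) i j.

Lemma grid0 (R : realType) (M : R) n : grid M n 0 = - M.
Proof. by rewrite /grid mul0r addr0. Qed.

Lemma gridn (R : realType) (M : R) n : (0 < n)%N -> grid M n n = M.
Proof.
move=> n0; rewrite /grid mulrC divfK ?pnatr_eq0 -?lt0n //; lra.
Qed.

Lemma grid_bound (R : realType) (M : R) n i : 0 < M -> (i <= n)%N ->
  `|grid M n i| <= M.
Proof.
move=> M0 ilen; have [n0|n0] := posnP n.
  by move: ilen; rewrite n0 leqn0 => /eqP ->; rewrite grid0 normrN gtr0_norm.
have n0' : 0 < n%:R :> R by rewrite ltr0n.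
have : i%:R * (2 * M / n%:R) <= 2 * M.
  rewrite mulrA ler_pdivrMr // mulrC ler_pM2l ?ler_nat //; lra.
have : 0 <= i%:R * (2 * M / n%:R).
  by rewrite mulr_ge0 // divr_ge0 // mulr_ge0 // ltW.
rewrite /grid => h1 h2; rewrite ler_norml; apply/andP; split; lra.
Qed.

Lemma near_mesh (R : realType) (M e : R) : 0 < e ->
  \forall n \near \oo, (0 < n)%N /\ `|2 * M / n%:R| < e.
Proof.
move=> e0.
near=> n.
have n0 : (0 < n)%N by near: n; exact: nbhs_infty_gt.
have n0' : 0 < n%:R :> R by rewrite ltr0n.
split => //; rewrite normrM normfV (gtr0_norm n0') ltr_pdivrMr //.
rewrite [e * _]mulrC -ltr_pdivrMr //; near: n; exact: nbhs_infty_gtr.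
Unshelve. all: by end_near. Qed.

Lemma ball_rV2 (R : realType) (x y : 'rV[R]_2) (e : R) :
  `|x 0 0 - y 0 0| < e -> `|x 0 1 - y 0 1| < e -> ball x e y.
Proof.
move=> h0 h1.
have e0 : 0 < e by exact: le_lt_trans h0.
split => // i j; rewrite (ord1 i) {i} /ball /=.
case: j => [[|[|//]] lt].
- by rewrite (_ : Ordinal lt = 0) //; exact: val_inj.
- by rewrite (_ : Ordinal lt = 1) //; exact: val_inj.
Qed.

(** * The degree counted on a grid *)

Lemma coord_le_norm (R : realType) n (x : 'rV[R]_n) i : `|x 0 i| <= `|x|.
Proof.
rewrite [leRHS]/Num.Def.normr/= mx_normrE.
exact: (le_bigmax _ (fun ij : 'I_1 * 'I_n => `|x ij.1 ij.2|) (0, i)).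
Qed.

Lemma norm_le_coord (R : realType) n (x : 'rV[R]_n) m : 0 <= m ->
  (forall i, `|x 0 i| <= m) -> `|x| <= m.
Proof.
move=> m0 xm; rewrite [leLHS]/Num.Def.normr/= mx_normrE bigmax_le //=.
by move=> -[i j] _ /=; rewrite (ord1 i).
Qed.

Lemma dist_continuous (R : realType) (V : normedModType R) (p : V) :
  continuous (fun x : V => `|x - p|).
Proof.
by move=> x; apply: cvg_norm; apply: cvgB; [apply: cvg_id|apply: cvg_cst].
Qed.

Lemma closed_box_compact (R : realType) n (p : 'rV[R]_n) (M : R) :
  compact [set x | `|x - p| <= M].
Proof.
apply: bounded_closed_compact.
  exists (`|p| + M); split; first exact: num_real.
  move=> m pm x /= xM; apply: le_trans (ltW pm).
  by rewrite -[x](subrK p) addrC (le_trans (ler_normD _ _)) // lerD.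
rewrite (_ : [set _ | _] = (fun x => `|x - p|) @^-1` [set y | y <= M]) //.
by apply: closed_comp; [move=> x _; exact: dist_continuous|exact: closed_le].
Qed.

(** Indices of vertices that can belong to one cell or to two cells with a
    common face. *)
Definition adjacent (a b : nat) := [|| a == b, a == b.+1 | b == a.+1].

Lemma dist_adjacent (R : realType) (c h e : R) a b : `|h| < e -> adjacent a b ->
  `|(c + a%:R * h) - (c + b%:R * h)| < e.
Proof.
move=> he; have e0 : 0 < e by exact: le_lt_trans he.
case/or3P => /eqP ->.
- by rewrite subrr normr0.
- by rewrite -natr1 (_ : _ - _ = h) //; ring.
- by rewrite -natr1 (_ : _ - _ = - h) ?normrN //; ring.
Qed.

Lemma ball_node (R : realType) (M e : R) n i i' j j' :
  `|2 * M / n%:R| < e -> adjacent i i' -> adjacent j j' ->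
  ball (node M n i j) e (node M n i' j').
Proof. by move=> *; apply: ball_rV2; rewrite !mxE /=; apply: dist_adjacent. Qed.

Lemma ball_time_node (R : realType) (M e : R) n k k' i i' j j' :
  `|1 / n%:R| < e -> `|2 * M / n%:R| < e ->
  adjacent k k' -> adjacent i i' -> adjacent j j' ->
  ball ((k%:R / n%:R, node M n i j) : R * 'rV[R]_2) e (k'%:R / n%:R, node M n i' j').
Proof.
move=> h1 h2 kk' ii' jj'; split; last exact: ball_node.
have := @dist_adjacent R 0 (1 / n%:R) e k k' h1 kk'.
by rewrite !add0r !mul1r.
Qed.

Lemma node_bound (R : realType) (M : R) n i j : 0 < M -> (i <= n)%N -> (j <= n)%N ->
  `|node M n i j| <= M.
Proof.
move=> M0 iln jln; apply: norm_le_coord; first exact: ltW.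
by move=> k; rewrite mxE; case: ifP => _; exact: grid_bound.
Qed.

Lemma node_border (R : realType) (M : R) n i j : 0 < M -> (0 < n)%N ->
  [|| i == 0%N, i == n, j == 0%N | j == n] -> M <= `|node M n i j|.
Proof.
move=> M0 n0; have MM : `|M| = M by rewrite gtr0_norm.
case/or4P => /eqP ->.
- by apply: le_trans (coord_le_norm _ 0); rewrite mxE /= grid0 normrN MM.
- by apply: le_trans (coord_le_norm _ 0); rewrite mxE /= gridn // MM.
- by apply: le_trans (coord_le_norm _ 1); rewrite mxE /= grid0 normrN MM.
- by apply: le_trans (coord_le_norm _ 1); rewrite mxE /= gridn // MM.
Qed.

(** The time interval is discretized with the same number n of steps.  On a fine
    grid a face with nonzero winding lies near a zero of F, where membership in O
    does not change, so slab_invariance applies at each of the n levels. *)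
Lemma grid_degree_homotopy (R : realType) (M : R)
    (F : R * 'rV[R]_2 -> 'rV[R]_2) (O : set (R * 'rV[R]_2)) :
  0 < M -> continuous F ->
  (forall z, 0 <= z.1 <= 1 -> `|z.2| <= M -> F z = 0 ->
     (\forall z' \near z, O z') \/ (\forall z' \near z, ~ O z')) ->
  (forall t x, M <= `|x| -> ~ O (t, x)) ->
  \forall n \near \oo,
    grid_degree M n (fun x => F (0, x)) [set x | O (0, x)] =
    grid_degree M n (fun x => F (1, x)) [set x | O (1, x)].
Proof.
move=> M0 cF FO OM.
pose K : set (R * 'rV[R]_2) := `[0, 1] `*` [set x | `|x - 0| <= M].
have cK : compact K.
  apply: compact_setX; first exact: segment_compact.
  exact: closed_box_compact.
have [|e e0 eQ] := @quad_uniform R _ K F (fun x y => O x <-> O y) cK cF.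
  move=> [t x] [/= t01]; rewrite subr0 => xM Fz.
  have [||W|W] := FO (t, x) _ _ Fz.
  - by rewrite in_itv in t01.
  - by [].
  - by exists O.
  - by exists (~` O).
near=> n.
have [n0 he1] : (0 < n)%N /\ `|2 * (1/2) / n%:R| < e.
  by near: n; exact: near_mesh.
have {}he1 : `|1 / n%:R| < e by move: he1; rewrite (_ : 2 * (1 / 2) = 1 :> R) //; field.
have [_ he2] : (0 < n)%N /\ `|2 * M / n%:R| < e.
  by near: n; exact: near_mesh.
pose chi k i j : int := (`[< O (k%:R / n%:R, node M n i j) >])%:R.
pose s k i j := signs (F (k%:R / n%:R, node M n i j)).
pose D k := \sum_(0 <= i < n) \sum_(0 <= j < n) chi k i j * cell (s k) i j.
have chi_border k i j : [|| i == 0%N, i == n, j == 0%N | j == n] -> chi k i j = 0.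
  by move=> b; rewrite /chi asboolF //; apply: OM; exact: node_border.
have inK k i j : (k <= n)%N -> (i <= n)%N -> (j <= n)%N ->
    K (k%:R / n%:R, node M n i j).
  move=> kn ilen jlen; split => /=; last by rewrite subr0 node_bound.
  rewrite in_itv /= divr_ge0 //= ler_pdivrMr ?ltr0n // mul1r ler_nat //.
have chiE k k' i i' j j' : O (k%:R / n%:R, node M n i j) <->
    O (k'%:R / n%:R, node M n i' j') -> chi k i j = chi k' i' j'.
  by move=> H; rewrite /chi; congr (nat_of_bool _)%:R; exact: asbool_equiv_eq.
have adj0 a : adjacent a a by rewrite /adjacent eqxx.
have adjS a : adjacent a a.+1 by rewrite /adjacent eqxx !orbT.
have adjP a : adjacent a.+1 a by rewrite /adjacent eqxx !orbT.
have DS k : (k < n)%N -> D k = D k.+1.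
  move=> kn; apply: slab_invariance.
  - by move=> j; apply: chi_border; rewrite eqxx.
  - by move=> j; apply: chi_border; rewrite eqxx !orbT.
  - by move=> j; apply: chi_border; rewrite eqxx !orbT.
  - by move=> j; apply: chi_border; rewrite eqxx !orbT.
  - move=> i j iln jln /(eQ _ (inK k i.+1 j (ltnW kn) iln (ltnW jln))) H.
    by apply: chiE; apply: H; exact: ball_time_node.
  - move=> i j iln jln /(eQ _ (inK k i j.+1 (ltnW kn) (ltnW iln) jln)) H.
    by apply: chiE; apply: H; exact: ball_time_node.
  - move=> i j iln jln /(eQ _ (inK k.+1 i j kn (ltnW iln) (ltnW jln))) H.
    by apply: chiE; apply: H; exact: ball_time_node.
have DE k : (k <= n)%N -> D 0%N = D k.
  by elim: k => [//|k IH] kn; rewrite -(DS _ kn); apply: IH; exact: ltnW.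
have := DE n (leqnn n).
by rewrite /D /chi /s mul0r divff // pnatr_eq0 -lt0n.
Unshelve. all: by end_near. Qed.

(** Cells with nonzero winding lie near zeros of F, where V and V' agree. *)
Lemma grid_degree_excision (R : realType) (M : R)
    (F : 'rV[R]_2 -> 'rV[R]_2) (V V' : set 'rV[R]_2) :
  0 < M -> continuous F ->
  (forall z, `|z| <= M -> F z = 0 -> \forall z' \near z, V z' <-> V' z') ->
  \forall n \near \oo, grid_degree M n F V = grid_degree M n F V'.
Proof.
move=> M0 cF FV.
have [|e e0 eQ] := @quad_uniform R _ [set x | `|x - 0| <= M] F (fun x _ => V x <-> V' x)
  (@closed_box_compact _ _ _ _) cF.
  move=> z /=; rewrite subr0 => /FV /[apply] VV'.
  by exists [set z' | V z' <-> V' z'].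
near=> n.
have [n0 he] : (0 < n)%N /\ `|2 * M / n%:R| < e.
  by near: n; exact: near_mesh.
have adj0 a : adjacent a a by rewrite /adjacent eqxx.
have adjS a : adjacent a a.+1 by rewrite /adjacent eqxx !orbT.
apply: eq_big_nat => i /andP[_ iln]; apply: eq_big_nat => j /andP[_ jln].
set c := cell _ _ _; have [->|c0] := eqVneq c 0; first by rewrite !mulr0.
congr ((nat_of_bool _)%:R * _); apply: asbool_equiv_eq.
apply: (eQ (node M n i j) _ _ _ _ _ _ (node M n i j)) c0; try exact: ball_node.
by rewrite /= subr0 node_bound // ltnW.
Unshelve. all: by end_near. Qed.

(** * Straight-line homotopies *)

Lemma det_mx22 (R : comNzRingType) (A : 'M[R]_2) :
  \det A = A 0 0 * A 1 1 - A 0 1 * A 1 0.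
Proof.
rewrite (expand_det_row _ 0) !big_ord_recl big_ord0 addr0 /cofactor !det_mx11 !mxE /=.
rewrite expr0 mul1r expr1 mulN1r mulrN.
by congr (_ * A _ _ - A _ _ * A _ _); apply: val_inj.
Qed.

Lemma mulmx_norm_le (R : realType) n (v : 'rV[R]_n) (A : 'M[R]_n) :
  `|v *m A| <= n%:R * `|A| * `|v|.
Proof.
apply: norm_le_coord => [|j]; first by rewrite !mulr_ge0.
rewrite mxE (le_trans (ler_norm_sum _ _ _)) //.
apply: (@le_trans _ _ (\sum_(k < n) (`|A| * `|v|))).
  apply: ler_sum => k _; rewrite normrM mulrC ler_pM //; last exact: coord_le_norm.
  rewrite [leRHS]/Num.Def.normr/= mx_normrE.
  exact: (le_bigmax _ (fun ij : 'I_n * 'I_n => `|A ij.1 ij.2|) (k, j)).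
by rewrite sumr_const card_ord -[_ *+ n]mulr_natl mulrA.
Qed.

Lemma mulmxr_continuous (R : realType) n (A : 'M[R]_n) :
  continuous (fun v : 'rV[R]_n => v *m A).
Proof.
move=> v; apply: (iffRL (@cvgrPdist_le R 'rV[R]_n 'rV[R]_n (nbhs v) _ _ _)) => /= e e0.
have C0 : 0 < n%:R * `|A| + 1 by rewrite ltr_wpDl // mulr_ge0.
near=> w; rewrite -mulmxBl (le_trans (mulmx_norm_le _ _)) //.
apply: (@le_trans _ _ ((n%:R * `|A| + 1) * `|v - w|)).
  by rewrite ler_wpM2r // lerDl.
rewrite mulrC -ler_pdivlMr //; near: w.
by apply: cvgr_dist_le => //; rewrite divr_gt0.
Unshelve. all: by end_near. Qed.

Lemma mulmx_eq0_det (R : realType) n (v : 'rV[R]_n) (A : 'M[R]_n) :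
  \det A != 0 -> v *m A = 0 -> v = 0.
Proof.
move=> detA vA; have uA : A \in unitmx by rewrite unitmxE unitfE.
by rewrite -(mulmxK uA v) vA mul0mx.
Qed.

Lemma straight_continuous (R : realType) (V W : normedModType R) (f0 f1 : V -> W) :
  continuous f0 -> continuous f1 ->
  continuous (fun z : R * V => (1 - z.1) *: f0 z.2 + z.1 *: f1 z.2).
Proof.
move=> c0 c1 z.
have c2 : {for z, continuous (fun z : R * V => z.2)} by exact: cvg_snd.
have c3 : {for z, continuous (fun z : R * V => z.1)} by exact: cvg_fst.
apply: cvgD; apply: cvgZ.
- by apply: cvgB; [exact: cvg_cst|exact: c3].
- by apply: (@continuous_comp _ _ _ (fun z : R * V => z.2) f0) => //; exact: c0.
- exact: c3.
- by apply: (@continuous_comp _ _ _ (fun z : R * V => z.2) f1) => //; exact: c1.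
Qed.

(** Homotopy invariance in the form of Poincare and Bohl: the segment from f0 to
    f1 must not vanish on the boundary of V.  This is expressed by requiring that
    each zero of the segment be interior or exterior to V. *)
Lemma grid_degree_straight (R : realType) (M : R)
    (f0 f1 : 'rV[R]_2 -> 'rV[R]_2) (V : set 'rV[R]_2) :
  0 < M -> continuous f0 -> continuous f1 ->
  (forall y t, `|y| <= M -> 0 <= t <= 1 -> (1 - t) *: f0 y + t *: f1 y = 0 ->
    (\forall y' \near y, V y') \/ (\forall y' \near y, ~ V y')) ->
  (forall y, M <= `|y| -> ~ V y) ->
  \forall n \near \oo, grid_degree M n f0 V = grid_degree M n f1 V.
Proof.
move=> M0 c0 c1 hV VM.
have H : forall W : set 'rV[R]_2, forall z : R * 'rV[R]_2,
    nbhs z.2 W -> \forall z' \near z, W z'.2.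
  by move=> W z zW; apply: cvg_snd zW.
have := @grid_degree_homotopy R M _ [set z | V z.2] M0 (straight_continuous c0 c1) _ _.
have -> : (fun x : 'rV[R]_2 => (1 - ((0 : R), x).1) *: f0 ((0 : R), x).2 + ((0 : R), x).1 *: f1 ((0 : R), x).2) = f0.
  by rewrite funeqE => x /=; rewrite subr0 scale1r scale0r addr0.
have -> : (fun x : 'rV[R]_2 => (1 - ((1 : R), x).1) *: f0 ((1 : R), x).2 + ((1 : R), x).1 *: f1 ((1 : R), x).2) = f1.
  by rewrite funeqE => x /=; rewrite subrr scale1r scale0r add0r.
apply=> // z z1 z2 Fz.
by have [W|W] := hV _ _ z2 z1 Fz; [left|right]; exact: (H _ z W).
Qed.

(** For a diagonal matrix the windings telescope, and only the signs of the two
    coordinates at the ends of the grid remain. *)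
Lemma grid_degree_separable (R : realType) (M : R) (x : 'rV[R]_2) (A : 'M[R]_2) n :
  (0 < n)%N -> `|x| < M -> A 0 1 = 0 -> A 1 0 = 0 -> A 0 0 != 0 -> A 1 1 != 0 ->
  grid_degree M n (fun y => (y - x) *m A) setT = 3 * sgz (\det A).
Proof.
move=> n0 xM A01 A10 A00 A11.
have M0 : 0 < M by exact: le_lt_trans xM.
pose a i := (0 < A 0 0 * (grid M n i - x 0 0))%R.
pose b i := (0 < A 1 1 * (grid M n i - x 0 1))%R.
have E i j : signs ((node M n i j - x) *m A) = (a i, b j).
  rewrite /signs !mxE !big_ord_recl !big_ord0 !mxE /=.
  have -> : lift ord0 ord0 = 1 :> 'I_2 by exact: val_inj.
  rewrite A01 A10 !mulr0 !addr0 add0r /a /b ![_ * A _ _]mulrC.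
  by [].
have jump (c u : R) : c != 0 -> `|u| < M ->
    (0 < c * (M - u))%R%:R - (0 < c * (- M - u))%R%:R = sgz c.
  move=> c0; rewrite ltr_norml => /andP[u1 u2].
  have h1 : 0 < M - u by lra.
  have h2 : - M - u < 0 by lra.
  have [cp|cn] := ltP 0 c.
    rewrite (pmulr_rgt0 _ cp) h1 (pmulr_rgt0 _ cp) ltNge (ltW h2) /=.
    by rewrite (gtr0_sgz cp).
  have {}cn : c < 0 by rewrite lt_neqAle c0.
  rewrite (nmulr_rgt0 _ cn) ltNge (ltW h1) /= (nmulr_rgt0 _ cn) h2.
  by rewrite (ltr0_sgz cn).
have aE : (a n)%:R - (a 0%N)%:R = sgz (A 0 0).
  by rewrite /a grid0 gridn // jump //; apply: le_lt_trans xM; exact: coord_le_norm.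
have bE : (b n)%:R - (b 0%N)%:R = sgz (A 1 1).
  by rewrite /b grid0 gridn // jump //; apply: le_lt_trans xM; exact: coord_le_norm.
rewrite /grid_degree det_mx22 A01 mul0r subr0 sgzM.
under eq_bigr => i _ do under eq_bigr => j _ do
  rewrite asboolT // mul1r /cell !E quad_product -mulrA.
under eq_bigr => i _ do rewrite -mulr_sumr -mulr_suml telescope_sumr // bE.
by rewrite -mulr_suml telescope_sumr // aE mulrA mulrC.
Qed.

(** * Degree of a linear map *)

Definition mx22 (R : realType) (a b c d : R) : 'M[R]_2 :=
  \matrix_(i, j) if i == 0 then (if j == 0 then a else b)
                 else (if j == 0 then c else d).

Lemma near_ltball (R : realType) (V : normedModType R) (x y : V) (r : R) :
  `|y - x| < r -> \forall y' \near y, `|y' - x| < r.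
Proof. by move=> yr; apply: cvgr_lt yr; exact: dist_continuous. Qed.

Lemma near_gtball (R : realType) (V : normedModType R) (x y : V) (r : R) :
  r < `|y - x| -> \forall y' \near y, ~ `|y' - x| < r.
Proof.
move=> yr; near=> y'; apply/negP; rewrite -leNgt ltW //; near: y'.
by apply: cvgr_gt yr; exact: dist_continuous.
Unshelve. all: by end_near. Qed.

Lemma shift_continuous (R : realType) (V : normedModType R) (x : V) :
  continuous (fun y : V => y - x).
Proof. by move=> y; apply: cvgB; [apply: cvg_id|apply: cvg_cst]. Qed.

Lemma affine_continuous (R : realType) n (x : 'rV[R]_n) (A : 'M[R]_n) :
  continuous (fun y : 'rV[R]_n => (y - x) *m A).
Proof.
move=> y; apply: (@continuous_comp 'rV[R]_n 'rV[R]_n 'rV[R]_n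
  (fun y => y - x) (fun v => v *m A) y); last exact: mulmxr_continuous.
exact: shift_continuous.
Qed.

Lemma ball_border (R : realType) n (x : 'rV[R]_n) (r M : R) : r <= M - `|x| ->
  forall y, M <= `|y| -> ~ `|y - x| < r.
Proof.
move=> rM y My yr.
have : `|y| <= `|y - x| + `|x| by rewrite -{1}(subrK x y) ler_normD.
lra.
Qed.

Lemma grid_degree_linear_homotopy (R : realType) (M r : R) (x : 'rV[R]_2)
    (A0 A1 : 'M[R]_2) :
  0 < r <= M - `|x| ->
  (forall t, 0 <= t <= 1 -> \det ((1 - t) *: A0 + t *: A1) != 0) ->
  \forall n \near \oo,
    grid_degree M n (fun y => (y - x) *m A0) [set y | `|y - x| < r] =
    grid_degree M n (fun y => (y - x) *m A1) [set y | `|y - x| < r].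
Proof.
move=> /andP[r0 rM] detA; apply: grid_degree_straight.
- by have := normr_ge0 x; lra.
- exact: affine_continuous.
- exact: affine_continuous.
- move=> y t _ t01; rewrite !scalemxAr -mulmxDr => /(mulmx_eq0_det (detA _ t01)) yx.
  by left; apply: near_ltball; rewrite yx normr0.
- exact: ball_border.
Qed.

(** Invertible 2x2 matrices of given determinant sign are joined to diagonal ones
    by segments of invertible matrices: first make the upper left entry nonzero,
    then clear the lower left entry, then the upper right one. *)
Lemma grid_degree_linear (R : realType) (M r : R) (x : 'rV[R]_2) (A : 'M[R]_2) :
  0 < r <= M - `|x| -> \det A != 0 ->
  \forall n \near \oo,
    grid_degree M n (fun y => (y - x) *m A) [set y | `|y - x| < r] =
    3 * sgz (\det A).
Proof.
move=> rM; wlog A00 : A / A 0 0 != 0 => [WL|] detA.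
  have [A0|] := eqVneq (A 0 0) 0; last by move=> A0; exact: WL.
  (* eta is nonzero and eta * A 1 1 is a nonnegative multiple of the determinant *)
  pose eta := if A 1 1 == 0 then 1 else - (A 0 1 * A 1 0 * A 1 1).
  have bc : A 0 1 * A 1 0 != 0.
    by move: detA; rewrite det_mx22 A0 mul0r sub0r oppr_eq0.
  have etaE : exists2 c, 0 <= c & eta * A 1 1 = c * - (A 0 1 * A 1 0).
    rewrite /eta; case: (eqVneq (A 1 1) 0) => [->|_]; first by exists 0; rewrite // mulr0 mul0r.
    exists (A 1 1 ^+ 2); first exact: sqr_ge0.
    by ring.
  have [c c0 cE] := etaE.
  pose B := mx22 eta (A 0 1) (A 1 0) (A 1 1).
  have detB : \det B = (c + 1) * \det A.
    by rewrite !det_mx22 A0 !mxE /= cE; ring.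
  have B00 : B 0 0 != 0.
    rewrite mxE /= /eta; case: (eqVneq (A 1 1) 0) => [_|d0]; first exact: oner_neq0.
    by rewrite oppr_eq0 mulf_neq0.
  have detB0 : \det B != 0 by rewrite detB mulf_neq0 // gt_eqF //; lra.
  have sB : sgz (\det B) = sgz (\det A).
    rewrite detB sgzM (gtr0_sgz (_ : 0 < c + 1)) ?mul1r //; lra.
  near=> n.
  rewrite -sB -(near (WL B B00 detB0) n) //; near: n.
  apply: grid_degree_linear_homotopy => // t /andP[t0 t1].
  rewrite (_ : \det _ = (t * c + 1) * \det A).
    by rewrite mulf_neq0 // gt_eqF // ltr_wpDl // mulr_ge0.
  rewrite !det_mx22 A0 !mxE /= A0.
  apply: (@etrans _ _ (t * (eta * A 1 1) - A 0 1 * A 1 0)); first by ring.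
  by rewrite cE; ring.
(* d is the value for which diag(a, d) has the determinant of A *)
pose a := A 0 0; pose d := \det A / a.
have ad : a * d = \det A by rewrite /d mulrC divfK.
have d0 : d != 0 by rewrite mulf_neq0 // invr_neq0.
pose B := mx22 a (A 0 1) 0 d; pose C := mx22 a 0 0 d.
have detC : \det C = \det A by rewrite det_mx22 !mxE /= mulr0 subr0.
have M0 : 0 < M by case/andP: rM; have := normr_ge0 x; lra.
have H1 := @grid_degree_linear_homotopy _ M r x A B rM.
have H2 := @grid_degree_linear_homotopy _ M r x B C rM.
have H3 := @grid_degree_excision _ M (fun y => (y - x) *m C) [set y | `|y - x| < r]
   setT M0 (@affine_continuous _ _ _ _).
near=> n.
transitivity (grid_degree M n (fun y => (y - x) *m B) [set y | `|y - x| < r]).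
  near: n; apply: H1 => t t01.
  rewrite (_ : \det _ = \det A) // -ad !det_mx22 !mxE /= -/a.
  rewrite (_ : d = (a * A 1 1 - A 0 1 * A 1 0) / a); last by rewrite /d det_mx22.
  by field.
transitivity (grid_degree M n (fun y => (y - x) *m C) [set y | `|y - x| < r]).
  near: n; apply: H2 => t t01.
  rewrite (_ : \det _ = \det A) // -ad !det_mx22 !mxE /= -/a.
  by ring.
transitivity (grid_degree M n (fun y => (y - x) *m C) setT).
  near: n; apply: H3 => y _ yC.
  have yx : y - x = 0 by apply: mulmx_eq0_det yC; rewrite detC.
  have yr : `|y - x| < r by rewrite yx normr0; case/andP: rM.
  by apply: filterS (near_ltball yr) => y' y'r; split.
rewrite -detC; apply: grid_degree_separable; rewrite ?mxE //.
- by near: n; exact: nbhs_infty_gt.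
- by case/andP: (rM) => r0 rM'; lra.
Unshelve. all: by end_near. Qed.

Lemma differentiable_near (R : realType) (V W : normedModType R) (h : V -> W) (x : V)
   (e : R) : differentiable h x -> 0 < e ->
  \forall y \near x, `|h y - h x - 'd h x (y - x)| <= e * `|y - x|.
Proof.
move=> dh e0.
have /eqaddoP/(_ e e0) H := diff_locally dh.
rewrite (near_shift 0) subr0; near=> v.
have : `|(h \o shift x - (cst (h x) + 'd h x)) v| <= e * `|v| by near: v; exact: H.
rewrite -![(_ - _) v]/(_ v - _ v) -![(_ + _) v]/(_ v + _ v) /= addrK.
by rewrite opprD addrA.
Unshelve. all: by end_near. Qed.

(** * Degree as a signed count of regular zeros *)

Lemma diffE_jacobian (R : realType) n (h : 'rV[R]_n -> 'rV[R]_n) x v :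
  'd h x v = v *m 'J h x.
Proof. by rewrite /jacobian mul_rV_lin1. Qed.

(** The derivative dominates the remainder near a regular zero, uniformly along
    the segment from h to its linear part.  The case t = 0 says that the zero is
    isolated. *)
Lemma regular_zero_isolated (R : realType) n (h : 'rV[R]_n -> 'rV[R]_n) x :
  differentiable h x -> h x = 0 -> \det ('J h x) != 0 ->
  \forall y \near x, forall t, 0 <= t <= 1 ->
    (1 - t) *: h y + t *: ((y - x) *m 'J h x) = 0 -> y = x.
Proof.
move=> dh hx detJ.
have uJ : 'J h x \in unitmx by rewrite unitmxE unitfE.
pose C := n%:R * `|invmx ('J h x)| + 1.
have C0 : 0 < C by rewrite ltr_wpDl // mulr_ge0.
have [e e0 Ce] : exists2 e : R, 0 < e & C * e < 1.
  by exists (C^-1 / 2); [rewrite divr_gt0 ?invr_gt0|rewrite mulrA divff ?gt_eqF //; lra].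
have := differentiable_near dh e0; apply: filterS => y.
rewrite hx subr0 diffE_jacobian; set v := y - x; set L := v *m _ => hL t /andP[t0 t1] H.
have LE : L = (1 - t) *: (L - h y).
  by rewrite scalerBr -[RHS]addr0 -H addrA subrK -scalerDl subrK scale1r.
have Lle : `|L| <= e * `|v|.
  rewrite LE normrZ ger0_norm; last by lra.
  apply: le_trans (_ : 1 * `|L - h y| <= _).
    by rewrite ler_wpM2r //; lra.
  by rewrite mul1r distrC.
have vle : `|v| <= C * `|L|.
  rewrite -{1}(mulmxK uJ v) (le_trans (mulmx_norm_le _ _)) //.
  by rewrite ler_wpM2r // lerDl.
have v0 : `|v| <= 0.
  have h1 : `|v| <= C * e * `|v|.
    by apply: le_trans vle _; rewrite -mulrA ler_wpM2l // ltW.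
  have h2 : (1 - C * e) * `|v| <= 0 by rewrite mulrBl mul1r; lra.
  by move: h2; rewrite pmulr_rle0 //; lra.
by apply/eqP; rewrite -subr_eq0 -normr_eq0 eq_le v0 normr_ge0.
Qed.

Lemma nbhs_closed_ball_le (R : realType) (V : normedModType R) (x : V) (P : set V) :
  nbhs x P -> \forall r \near (0 : R)^'+, forall y, `|y - x| <= r -> P y.
Proof.
move=> /nbhs_ballP[e /= e0 eP]; near=> r => y yr.
have re : r < e by near: r; exact: nbhs_right_lt.
by apply: eP; rewrite -ball_normE /= distrC; exact: le_lt_trans re.
Unshelve. all: by end_near. Qed.

Lemma grid_degree_regular_zero (R : realType) (M : R)
    (h : 'rV[R]_2 -> 'rV[R]_2) (x : 'rV[R]_2) :
  continuous h -> differentiable h x -> h x = 0 -> \det ('J h x) != 0 -> `|x| < M ->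
  \forall r \near (0 : R)^'+, \forall n \near \oo,
    grid_degree M n h [set y | `|y - x| < r] = 3 * sgz (\det ('J h x)).
Proof.
move=> ch dh hx detJ xM.
have M0 : 0 < M by exact: le_lt_trans xM.
near=> r.
have r0 : 0 < r by [].
have rM : r <= M - `|x|.
  by near: r; apply: nbhs_right_le; rewrite subr_gt0.
have H : forall y, `|y - x| <= r -> forall t, 0 <= t <= 1 ->
    (1 - t) *: h y + t *: ((y - x) *m 'J h x) = 0 -> y = x.
  by near: r; exact: (nbhs_closed_ball_le (regular_zero_isolated dh hx detJ)).
near=> n.
transitivity (grid_degree M n (fun y => (y - x) *m 'J h x) [set y | `|y - x| < r]).
  near: n; apply: grid_degree_straight => //.
  - exact: affine_continuous.
  - move=> y t _ t01 yt; have [yr|yr] := leP (`|y - x|) r; [left|right].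
      by rewrite (H y yr t t01 yt); apply: near_ltball; rewrite subrr normr0.
    exact: near_gtball.
  - exact: ball_border.
by near: n; apply: grid_degree_linear; rewrite ?r0.
Unshelve. all: by end_near. Qed.

Lemma grid_degree_disjointU (R : realType) (M : R) n (F : 'rV[R]_2 -> 'rV[R]_2)
    (V W : set 'rV[R]_2) : (forall x, V x -> ~ W x) ->
  grid_degree M n F (V `|` W) = grid_degree M n F V + grid_degree M n F W.
Proof.
move=> VW; rewrite /grid_degree -big_split; apply: eq_bigr => i _.
rewrite -big_split; apply: eq_bigr => j _ /=; rewrite -mulrDl; congr (_ * _).
rewrite asbool_or; set x := node _ _ _ _.
case: (asboolP (V x)) => Vx; case: (asboolP (W x)) => Wx //.
by case: (VW x).
Qed.

Lemma grid_degree_set0 (R : realType) (M : R) n (F : 'rV[R]_2 -> 'rV[R]_2) :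
  grid_degree M n F set0 = 0.
Proof.
rewrite /grid_degree big1 // => i _; rewrite big1 // => j _.
by rewrite asboolF ?mul0r.
Qed.

(** By induction on the list of zeros: cut a small ball around the first zero out
    of V, where the degree is the sign of the determinant. *)
Lemma grid_degree_count (R : realType) (M : R) (h : 'rV[R]_2 -> 'rV[R]_2)
    (s : seq 'rV[R]_2) (V : set 'rV[R]_2) :
  0 < M -> (forall x, differentiable h x) -> uniq s ->
  (forall y, V y -> `|y| < M) ->
  (forall z, h z = 0 -> (\forall y \near z, V y) \/ (\forall y \near z, ~ V y)) ->
  (forall x, x \in s <-> V x /\ h x = 0) ->
  (forall x, x \in s -> \det ('J h x) != 0) ->
  \forall n \near \oo, grid_degree M n h V = 3 * \sum_(x <- s) sgz (\det ('J h x)).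
Proof.
move=> M0 dh; have ch : continuous h.
  by move=> x; exact: differentiable_continuous.
elim: s V => [|x s IH] V us VM hV sV sJ.
  near=> n; rewrite big_nil mulr0 -(grid_degree_set0 M n h); near: n.
  apply: grid_degree_excision => // z _ hz.
  have [Vz|Vz] := hV z hz.
    by have := (sV z).2 (conj (nbhs_singleton Vz) hz).
  by apply: filterS Vz => y nVy; split.
have [Vx hx] : V x /\ h x = 0 by apply/sV; rewrite mem_head.
have detJ : \det ('J h x) != 0 by apply: sJ; rewrite mem_head.
have nVx : \forall y \near x, V y.
  by case: (hV x hx) => // /nbhs_singleton.
near (0 : R)^'+ => r.
have r0 : 0 < r by [].
have iso : forall y, `|y - x| <= r -> h y = 0 -> y = x.
  move=> y yr hy.
  suff H : forall y, `|y - x| <= r -> forall t, 0 <= t <= 1 ->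
      (1 - t) *: h y + t *: ((y - x) *m 'J h x) = 0 -> y = x.
    by apply: (H y yr 0); rewrite ?lexx ?ler01 // subr0 scale1r scale0r addr0.
  by near: r; exact: (nbhs_closed_ball_le (regular_zero_isolated (dh x) hx detJ)).
have Dx : \forall n \near \oo,
    grid_degree M n h [set y | `|y - x| < r] = 3 * sgz (\det ('J h x)).
  by near: r; apply: grid_degree_regular_zero => //; exact: VM.
pose V' := V `\` [set y | `|y - x| < r].
have farx z : h z = 0 -> z != x -> \forall y \near z, ~ `|y - x| < r.
  move=> hz zx; apply: near_gtball; rewrite ltNge; apply/negP => zr.
  by rewrite (iso z zr hz) eqxx in zx.
have nearx : \forall y \near x, `|y - x| < r.
  by apply: near_ltball; rewrite subrr normr0.
have DV' : \forall n \near \oo,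
    grid_degree M n h V' = 3 * \sum_(x <- s) sgz (\det ('J h x)).
  apply: IH.
  - by case/andP: us.
  - by move=> y [Vy _]; exact: (VM y Vy).
  - move=> z hz; have [->|zx] := eqVneq z x.
      by right; apply: filterS nearx => y yx [_].
    have [Vz|Vz] := hV z hz; [left|right].
      by apply: filterS2 Vz (farx z hz zx) => y Vy yx; split.
    by apply: filterS Vz => y nVy [].
  - move=> y; split.
      move=> ys; have [Vy hy] : V y /\ h y = 0 by apply/sV; rewrite in_cons ys orbT.
      split => //; split => // yr.
      move: us => /=; rewrite -(iso y _ hy) ?ys //; exact: ltW.
    move=> [[Vy yr] hy]; have := (sV y).2 (conj Vy hy); rewrite in_cons.
    by case/orP => // /eqP yx; case: yr; rewrite yx /= subrr normr0.
  - by move=> y ys; apply: sJ; rewrite in_cons ys orbT.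
have DV : \forall n \near \oo,
    grid_degree M n h V = grid_degree M n h ([set y | `|y - x| < r] `|` V').
  apply: grid_degree_excision => // z _ hz; have [->|zx] := eqVneq z x.
    by apply: filterS2 nVx nearx => y Vy yx; split => // _; left.
  apply: filterS (farx z hz zx) => y yr; split=> [Vy|[//|[]//]].
  by right; split.
near=> n.
rewrite big_cons mulrDr -(near DV' n) // -(near Dx n) // (near DV n) //.
by rewrite grid_degree_disjointU // => y yr [_].
Unshelve. all: by end_near. Qed.

(** * Comparison with the Brouwer index *)

(** A nonzero index is realized by some isolating neighborhood U and some
    approximation h with regular zeros.  On the boundary of U the map g is
    larger than h - g, so that the segment from g to h has no zeros there; excision
    then replaces U by a ball around p.  A sum over infinitely many zeros would
    be 0 by convention, so the zeros of h in U are finite in number. *)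
Lemma zero_index_grid_degree (R : realType) (g : 'rV[R]_2 -> 'rV[R]_2) (p : 'rV[R]_2) :
  continuous g -> zero_index g p != 0 ->
  exists2 M0 : R, 0 < M0 & forall M r, M0 <= M -> 0 < r <= M - `|p| ->
    (forall y, `|y - p| <= r -> g y = 0 -> y = p) ->
    \forall n \near \oo, grid_degree M n g [set y | `|y - p| < r] != 0.
Proof.
move=> cg; rewrite /zero_index; case: xgetP => [_ _ [U [oU bU Up isoU] ->]|]; last by rewrite eqxx.
rewrite /degree; case: xgetP => [_ _ [h [[dh _] hJ [e [hg eg]]] ->]|]; last by rewrite eqxx.
set Z := [set x | U x /\ h x = 0] => sum0.
(* every term of the sum is nonzero, so its support is Z *)
have finZ : finite_set Z.
  apply: contrapT => infZ; move: sum0; rewrite fsbig_dflt ?eqxx //.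
  rewrite (_ : _ `&` _ = Z) //; apply/seteqP; split => [x []//|x Zx]; split => //=.
  by case: Zx => Ux hx; apply/eqP; rewrite sgz_eq0; exact: hJ.
rewrite fsbig_finite //= in sum0.
have ch : continuous h by move=> x; exact: differentiable_continuous.
have [N [_ NU]] := bU.
pose B := `|N| + 1.
have UB y : U y -> `|y| <= B.
  by move=> Uy; apply: NU => //; rewrite /B; have := ler_norm N; lra.
have B0 : 0 < B by rewrite /B; have := normr_ge0 N; lra.
exists (B + 1); first by lra.
move=> M r BM /andP[r0 rM] isor.
have M0 : 0 < M by lra.
have UM y : U y -> `|y| < M by move=> /UB; lra.
have bdry y : (\forall y' \near y, U y') \/ (\forall y' \near y, ~ U y') \/ boundary U y.
  have [Uy|nUy] := pselect (U y); first by left; apply: open_nbhs_nbhs; split.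
  have [cUy|ncUy] := pselect (closure U y).
    by right; right; split => // /interior_subset.
  right; left; have : open_nbhs y (~` closure U).
    by split => //; apply: closed_openC; exact: closed_closure.
  move/open_nbhs_nbhs; apply: filterS => z nz Uz; apply: nz; exact: subset_closure.
have bdry0 y t : 0 <= t <= 1 -> boundary U y -> (1 - t) *: g y + t *: h y <> 0.
  move=> /andP[t0 t1] [clU nU] H.
  have h1 := eg y (conj clU nU); have h2 := hg y clU.
  have : `|g y| <= `|h y - g y|.
    have gE : g y = - (t *: (h y - g y)).
      rewrite -[LHS]subr0 -H scalerBl scale1r scalerBr.
      by rewrite !opprD !opprK !addrA subrr add0r addrC.
    by rewrite {1}gE normrN normrZ ger0_norm // ler_piMl.
  by lra.
have Dgh : \forall n \near \oo, grid_degree M n g U = grid_degree M n h U.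
  apply: grid_degree_straight => //.
    move=> y t _ t01 H; have [|[|/(bdry0 _ _ t01)]//] := bdry y; by [left|right].
  by move=> y My /UM; rewrite ltNge My.
have Dh : \forall n \near \oo, grid_degree M n h U =
    3 * \sum_(x <- finmap.enum_fset (fset_set Z)) sgz (\det ('J h x)).
  apply: grid_degree_count => //; first exact: finmap.fset_uniq.
  - move=> z hz; have [|[|Uz]] := bdry z; [by left|by right|].
    by case: (bdry0 z 1 _ Uz); rewrite ?ler01 ?lexx // subrr scale0r add0r scale1r.
  - by move=> x; rewrite in_fset_set // inE.
  - by move=> x; rewrite in_fset_set // inE => -[Ux hx]; exact: hJ.
have Dp : \forall n \near \oo, grid_degree M n g U = grid_degree M n g [set y | `|y - p| < r].
  apply: grid_degree_excision => // z _ gz; have [->|zp] := eqVneq z p.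
    have Up' : \forall y \near p, U y by apply: open_nbhs_nbhs; split.
    have pr : `|p - p| < r by rewrite subrr normr0.
    by apply: filterS2 Up' (near_ltball pr) => y Uy yp; split.
  have far : r < `|z - p|.
    by rewrite ltNge; apply/negP => /isor/(_ gz) E; rewrite E eqxx in zp.
  have ncl : \forall y \near z, ~ U y.
    have [|[//|[clU _]]] := bdry z; last by move: zp; rewrite (isoU z clU gz) eqxx.
    by move/nbhs_singleton/subset_closure => clU; move: zp; rewrite (isoU z clU gz) eqxx.
  by apply: filterS2 ncl (near_gtball far) => y nU nr; split.
near=> n; rewrite -(near Dp n) // (near Dgh n) // (near Dh n) // mulf_neq0 //.
Unshelve. all: by end_near. Qed.

(** * Continuation of zeros *)

Definition clopen_in (X : topologicalType) (Z D : set X) : Prop :=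
  [/\ D `<=` Z, closed D & closed (Z `\` D)].

Definition quasi_component (X : topologicalType) (Z : set X) (p : X) : set X :=
  [set x | Z x /\ forall D, clopen_in Z D -> D p -> D x].

Lemma closed_quasi_component (X : topologicalType) (Z : set X) (p : X) :
  closed Z -> closed (quasi_component Z p).
Proof.
move=> cZ x qx; split.
  by apply: cZ; apply: closureS qx => y [].
move=> D cD Dp; have [_ clD _] := cD.
by apply: clD; apply: closureS qx => y [_ /(_ D cD Dp)].
Qed.

Lemma clopen_inI (X : topologicalType) (Z D E : set X) :
  clopen_in Z D -> clopen_in Z E -> clopen_in Z (D `&` E).
Proof.
move=> [DZ cD cD'] [EZ cE cE']; split; first by move=> x [/DZ].
  exact: closedI.
by rewrite setDIr; exact: closedU.
Qed.

(** Clopen sets that contain p are stable under intersection, so compactness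
    yields one of them inside any open set containing all points that cannot be
    separated from p. *)
Lemma quasi_component_clopen (X : topologicalType) (Z W : set X) (p : X) :
  compact Z -> closed Z -> Z p -> open W -> quasi_component Z p `<=` W ->
  exists D, [/\ clopen_in Z D, D p & D `<=` W].
Proof.
move=> cptZ cZ Zp oW qW; apply: contrapT => noD.
pose I := [set D | clopen_in Z D /\ D p].
have IZ : I Z.
  by split => //; split => //; rewrite setDv; exact: closed0.
pose G := filter_from I (fun D => D `\` W).
have FG : ProperFilter G.
  apply: filter_from_proper.
    apply: filter_from_filter; first by exists Z.
    move=> D E [cD Dp] [cE Ep]; exists (D `&` E).
      by split => //; exact: clopen_inI.
    by move=> x [[Dx Ex] nW].
  move=> D [cD Dp]; apply/set0P/negP => /eqP; rewrite setD_eq0 => DW.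
  by apply: noD; exists D.
have [x [Zx clx]] : Z `&` cluster G !=set0.
  by apply: cptZ; exists Z => // x [].
have H D : I D -> D x /\ ~ W x.
  move=> ID; have [[_ cD _] _] := ID.
  have : closed (D `\` W) by apply: closedI => //; exact: open_closedC.
  move=> /(_ x); apply; move=> B Bx.
  by apply: clx => //; exists D.
have [_ nWx] := H Z IZ.
by apply/nWx/qW; split => // D cD Dp; have [] := H D (conj cD Dp).
Qed.

(** The two parts of a disconnection would be separated by open sets, and a clopen
    set of Z contained in their union would split along them, so it would
    separate p from one of the parts. *)
Lemma connected_quasi_component (R : realType) (X : pseudoMetricType R)
    (Z : set X) (p : X) : compact Z -> closed Z -> Z p ->
  connected (quasi_component Z p).
Proof.
move=> cptZ cZ Zp; apply/connectedP => E [E0 EU [sE1 sE2]].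
have clq := closed_quasi_component (p := p) cZ.
have Eq b : E b `<=` quasi_component Z p.
  by rewrite EU; case: b => x Ex; [right|left].
have clE b : closed (E b).
  move=> x Ex; have : quasi_component Z p x.
    by apply: clq; apply: closureS Ex; exact: Eq.
  rewrite EU; case: b Ex => Ex [] // Ex'.
    by exfalso; move: sE2; apply/eqP/set0P; exists x.
  by exfalso; move: sE1; apply/eqP/set0P; exists x.
have E10 : E false `&` E true = set0.
  by rewrite -subset0 -[X in _ `<=` X]sE1; apply: setSI; exact: subset_closure.
have /(@normal_openP R) H := @pseudometric_normal R X.
have [U1 [U2 [oO1 oO2 EO1 EO2 O12]]] := H _ _ (clE false) (clE true) E10.
pose O b := if b then U2 else U1.
have oO b : open (O b) by case: b.
have EO b : E b `<=` O b by case: b.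
have Odisj b x : O b x -> O (~~ b) x -> False.
  by case: b => /= h1 h2; rewrite -[False]/(set0 x) -O12; split.
have [b Ep] : exists b, E b p.
  have : quasi_component Z p p by split.
  by rewrite EU => -[]; [exists false|exists true].
have [|D [[DZ cD cD'] Dp DW]] := @quasi_component_clopen X Z (O true `|` O false) p cptZ cZ Zp (openU (oO _) (oO _)).
  by rewrite EU => x [/EO|/EO]; [right|left].
have DE : D `&` O b = D `\` O (~~ b).
  apply/seteqP; split => x [Dx Ox]; split => //; first exact: Odisj.
  by case: (DW x Dx); case: (b) Ox.
have cDO : clopen_in Z (D `&` O b).
  split; first by move=> x [/DZ].
    by rewrite DE; apply: closedI => //; exact: open_closedC.
  rewrite setDIr; apply: closedU => //.
  by rewrite -(setIid Z) -setIDA; apply: closedI => //; apply: closedI => //; exact: open_closedC.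
have [y Ey] := E0 (~~ b).
have [_ /(_ _ cDO) []] := Eq _ _ Ey.
  by split => //; exact: EO.
by move=> _ Oy; apply: (Odisj b y) => //; exact: EO.
Qed.

Lemma slice_continuous (R : realType) (V : normedModType R) (t : R) :
  continuous (fun x : V => (t, x)).
Proof.
move=> x U [[A B] [/= tA xB] ABU]; apply: filterS xB => y By.
by apply: ABU; split => //=; exact: nbhs_singleton.
Qed.

(** If every point of the quasi-component of (0, p) were at level 0, then it
    would be the single point (0, p), which could be separated from the rest of
    the zeros inside a small cylinder over the ball.  The degree at level 0 would
    then equal the degree over the empty slice at level 1. *)
Lemma continuation (R : realType) (F : R * 'rV[R]_2 -> 'rV[R]_2) (p : 'rV[R]_2)
    (M r : R) :
  continuous F -> 0 < r <= M - `|p| -> F (0, p) = 0 ->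
  (forall y, `|y - p| <= r -> F (0, y) = 0 -> y = p) ->
  (\forall n \near \oo,
     grid_degree M n (fun y => F (0, y)) [set y | `|y - p| < r] != 0) ->
  exists C : set (R * 'rV[R]_2),
    [/\ connected C, C (0, p),
        forall z, C z -> [/\ 0 <= z.1 <= 1, `|z.2 - p| <= r & F z = 0]
      & exists2 z, C z & 0 < z.1].
Proof.
move=> cF /andP[r0 rM] Fp iso deg.
have M0 : 0 < M by have := normr_ge0 p; lra.
pose Z := (`[0, 1] `*` [set x | `|x - p| <= r]) `&` [set z | F z = 0].
have cptB : compact (`[0, 1] `*` [set x | `|x - p| <= r] : set (R * 'rV[R]_2)).
  apply: compact_setX; first exact: segment_compact.
  exact: closed_box_compact.
have clF : closed [set z | F z = 0].
  rewrite (_ : [set _ | _] = F @^-1` [set 0]) //.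
  by apply: closed_comp; [move=> z _; exact: cF|apply: accessible_closed_set1; apply: hausdorff_accessible; exact: norm_hausdorff].
have cZ : closed Z.
  by apply: closedI => //; apply: compact_closed => //; exact: norm_hausdorff.
have cptZ : compact Z by apply: compact_closedI.
have Zp : Z (0, p).
  by split=> //; split; rewrite /= ?in_itv /= ?lexx ?ler01 // subrr normr0 ltW.
have cK := connected_quasi_component cptZ cZ Zp.
have [[z [Kz z0]]|nK] := pselect (exists z, quasi_component Z (0, p) z /\ 0 < z.1).
  exists (quasi_component Z (0, p)); split => //.
  - by move=> x [[[x1 x2] Fx] _]; split => //; rewrite /= in_itv in x1.
  - by exists z.
(* from here on, all points of the quasi-component are at level 0 *)
exfalso.
have Kp z : quasi_component Z (0, p) z -> z = (0, p).
  move=> Kz; case: (Kz) => [[[z1 z2] Fz] _].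
  have z10 : z.1 = 0.
    apply/eqP; rewrite eq_le; apply/andP; split; last first.
      by move: z1; rewrite /= in_itv => /andP[].
    by rewrite leNgt; apply/negP => z10; apply: nK; exists z.
  case: z z10 z2 Fz {Kz z1} => t y /= -> z2 Fz.
  by rewrite (iso y z2 Fz).
pose W : set (R * 'rV[R]_2) := [set z | z.1 < 1 /\ `|z.2 - p| < r].
have nearW (z : R * 'rV[R]_2) (P : set 'rV[R]_2) : nbhs z.2 P -> \forall z' \near z, P z'.2.
  by move=> zP; apply: cvg_snd zP.
have oW : open W.
  rewrite openE => z [z1 z2]; apply: filterI.
    have : nbhs z.1 [set t : R | t < 1].
      by apply: open_nbhs_nbhs; split => //; exact: open_lt.
    by move=> h; apply: cvg_fst h.
  exact: (nearW _ _ (near_ltball z2)).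
have Wp : W (0, p) by split; rewrite /= ?ltr01 // subrr normr0.
have [|D [[DZ cD cD'] Dp DW]] := quasi_component_clopen cptZ cZ Zp oW.
  by move=> z /Kp ->.
have /(@normal_openP R) H := @pseudometric_normal R (R * 'rV[R]_2)%type.
have [|U1 [U2 [oO1 oO2 DO1 DO2 O12]]] := H _ _ cD cD'.
  by rewrite -subset0 => z [Dz []].
pose O := U1 `&` W.
have oO : open O by exact: openI.
(* F has no zero on the boundary of O: its zeros lie in D, in Z minus D, or
   outside of the closed ball *)
have deg0 : \forall n \near \oo,
    grid_degree M n (fun x => F (0, x)) [set x | O (0, x)] =
    grid_degree M n (fun x => F (1, x)) [set x | O (1, x)].
  apply: grid_degree_homotopy => //.
    move=> z z01 _ Fz; have [zr|zr] := leP `|z.2 - p| r; last first.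
      right; apply: filterS (nearW _ _ (near_gtball zr)) => z' nz [_ [_]]; exact: nz.
    have Zz : Z z by split => //; split => //; rewrite /= in_itv.
    have [Dz|nDz] := pselect (D z).
      by left; apply: open_nbhs_nbhs; split => //; split; [exact: DO1|exact: DW].
    right; have : nbhs z U2 by apply: open_nbhs_nbhs; split => //; apply: DO2.
    by apply: filterS => z' u2z [u1z _]; rewrite -[False]/(set0 z') -O12; split.
  move=> t x Mx [_ [_ /= xr]]; exact: (ball_border rM Mx xr).
have exc : \forall n \near \oo,
    grid_degree M n (fun x => F (0, x)) [set x | O (0, x)] =
    grid_degree M n (fun x => F (0, x)) [set y | `|y - p| < r].
  have c0 : continuous (fun x : 'rV[R]_2 => (0 : R, x)).
    exact: slice_continuous.
  apply: grid_degree_excision => //.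
    move=> x; apply: (@continuous_comp _ _ _ (fun x : 'rV[R]_2 => (0 : R, x)) F).
      exact: c0.
    exact: cF.
  move=> z _ Fz; have [zr|zr] := leP `|z - p| r; last first.
    by apply: filterS (near_gtball zr) => y yr; split => [[_ []]|/yr].
  rewrite (iso z zr Fz).
  have nO : nbhs p [set x | O (0, x)].
    apply: (c0 p); apply: open_nbhs_nbhs; split => //; split => //; exact: DO1.
  have pr : `|p - p| < r by rewrite subrr normr0.
  by apply: filterS2 nO (near_ltball pr) => y Oy yr.
have : \forall n \near \oo, False.
  near=> n.
  have d1 : grid_degree M n (fun x => F (1, x)) [set x | O (1, x)] = 0.
    rewrite (_ : [set x | O (1, x)] = set0) ?grid_degree_set0 //.
    by rewrite -subset0 => x [_ [/=]]; rewrite ltxx.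
  have : grid_degree M n (fun y => F (0, y)) [set y | `|y - p| < r] != 0.
    by near: n.
  by rewrite -(near exc n) // (near deg0 n) // d1 eqxx.
by case/filter_ex.
Unshelve. all: by end_near. Qed.

(** * Antiderivatives on the line *)

Definition primitive (R : realType) (k K : R -> R) : Prop :=
  forall t : R, is_derive t 1 K (k t).

Lemma primitiveD (R : realType) (k1 k2 K1 K2 : R -> R) :
  primitive k1 K1 -> primitive k2 K2 ->
  primitive (fun t => k1 t + k2 t) (fun t => K1 t + K2 t).
Proof. by move=> h1 h2 t; have := h1 t; have := h2 t => ? ?; exact: is_deriveD. Qed.

Lemma primitiveZ (R : realType) (c : R) (k K : R -> R) :
  primitive k K -> primitive (fun t => c * k t) (fun t => c * K t).
Proof. by move=> h t; have := h t => ?; exact: is_deriveZ. Qed.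

Lemma primitiveB (R : realType) (k1 k2 K1 K2 : R -> R) :
  primitive k1 K1 -> primitive k2 K2 ->
  primitive (fun t => k1 t - k2 t) (fun t => K1 t - K2 t).
Proof. by move=> h1 h2 t; have := h1 t; have := h2 t => ? ?; exact: is_deriveB. Qed.

Lemma primitive_cst (R : realType) (c : R) : primitive (fun=> 0) (fun=> c).
Proof. by move=> t; exact: is_derive_cst. Qed.

Lemma primitive_eq (R : realType) (k k' K : R -> R) :
  (forall t, k t = k' t) -> primitive k K -> primitive k' K.
Proof. by move=> kk' h t; rewrite -kk'. Qed.

Lemma primitive_linear (R : realType) (c : R) : primitive (fun=> c) (fun t => c * t).
Proof.
apply: (primitive_eq (k := fun t => c * 1)) => [t|]; first by rewrite mulr1.
by apply: (primitiveZ c (K := fun t => t)) => t; exact: is_derive_id.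
Qed.

Lemma primitiveM (R : realType) (k1 k2 K1 K2 : R -> R) :
  primitive k1 K1 -> primitive k2 K2 ->
  primitive (fun t => k1 t * K2 t + K1 t * k2 t) (fun t => K1 t * K2 t).
Proof.
move=> h1 h2 t; have H1 := h1 t; have H2 := h2 t.
have /is_derive_eq := @is_deriveM _ _ K1 K2 t 1 _ _ H1 H2; apply.
by rewrite addrC; congr (_ + _); rewrite /GRing.scale /= mulrC.
Qed.

Lemma primitive_shift (R : realType) (T : R) (k K : R -> R) :
  primitive k K -> primitive (fun t => k (t + T)) (fun t => K (t + T)).
Proof.
move=> h t; have h1 := h (t + T).
have h2 : is_derive t (1:R) (fun t => t + T) 1.
  have /is_derive_eq := is_deriveD (is_derive_id t 1) (is_derive_cst T t 1); apply.
  by rewrite addr0.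
by have := @is_derive1_comp _ K (fun t => t + T) t _ _ h1 h2; rewrite mulr1.
Qed.

Lemma primitive_expR (R : realType) (mu : R) :
  primitive (fun t => mu * expR (mu * t)) (fun t => expR (mu * t)).
Proof.
move=> t; have h2 : is_derive t (1:R) (fun t => mu * t) mu by exact: primitive_linear.
have := @is_derive1_comp _ expR (fun t => mu * t) t _ _ (is_derive_expR _) h2.
by rewrite mulrC.
Qed.

Lemma primitive_continuous (R : realType) (k K : R -> R) :
  primitive k K -> continuous K.
Proof.
move=> h t; apply: differentiable_continuous; apply/derivable1_diffP.
by have [] := h t.
Qed.

Lemma primitive_mvt_le (R : realType) (k K : R -> R) (a b : R) :
  primitive k K -> a <= b -> exists c, a <= c <= b /\ K b - K a = k c * (b - a).
Proof.
move=> h ab; have [|c cI ->] := @MVT_segment R K k a b ab (fun x _ => h x).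
  exact/continuous_subspaceT/primitive_continuous.
by exists c; rewrite in_itv in cI.
Qed.

Lemma primitive_mvt (R : realType) (k K : R -> R) (a b : R) :
  primitive k K -> exists c, K b - K a = k c * (b - a).
Proof.
move=> h; have [ab|ab] := leP a b.
  by have [c [_ cE]] := primitive_mvt_le h ab; exists c.
have [c [_ cE]] := primitive_mvt_le h (ltW ab); exists c.
by rewrite -opprB cE -mulrN opprB.
Qed.

Lemma primitive0_cst (R : realType) (K : R -> R) :
  primitive (fun=> 0) K -> forall a b, K a = K b.
Proof.
move=> h a b; have [c] := primitive_mvt b a h.
by rewrite mul0r => /eqP; rewrite subr_eq0 => /eqP.
Qed.

Lemma local_primitive (R : realType) (k : R -> R) (N : nat) : continuous k ->
  exists2 H : R -> R, H 0 = 0 & forall x : R, `|x| < N.+1%:R -> is_derive x 1 H (k x).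
Proof.
move=> ck; pose a : R := - N.+1%:R; pose b : R := N.+1%:R.
pose F x := (\int[lebesgue_measure]_(t in [set` `[a, x]]) (k t))%R.
have intk : lebesgue_measure.-integrable `[a, b] (EFin \o k).
  apply: continuous_compact_integrable; first exact: segment_compact.
  exact: continuous_subspaceT.
exists (fun x => F x - F 0); first by rewrite subrr.
move=> x; rewrite ltr_norml => /andP[ax xb].
have [dF FE] := @continuous_FTC1_closed R k a x b xb intk ax (ck x).
have FD : is_derive x 1 F (k x) by apply: DeriveDef => //; rewrite -derive1E.
have /is_derive_eq := is_deriveB FD (is_derive_cst (F 0) x 1); apply.
by rewrite subr0.
Qed.

(** Integrals over the windows ]-N-1, N+1[ agree on overlaps after normalization at
    0, and each point has a neighborhood inside a window. *)
Lemma exists_primitive (R : realType) (k : R -> R) : continuous k ->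
  exists K, primitive k K.
Proof.
move=> ck.
have /choice[H HP] : forall N : nat, exists H : R -> R, H 0 = 0 /\
    forall x : R, `|x| < N.+1%:R -> is_derive x 1 H (k x).
  by move=> N; have [H H0 HD] := local_primitive N ck; exists H.
have Hagree N m x : `|x| < N.+1%:R -> (N <= m)%N -> H m x = H N x.
  move=> xN Nm; have xm : `|x| < m.+1%:R.
    by apply: lt_le_trans xN _; rewrite ler_nat.
  pose D (y : R) := H m y - H N y.
  have DD (y : R) : `|y| <= `|x| -> is_derive y (1:R) D 0.
    move=> yx; have h1 := (HP m).2 y (le_lt_trans yx xm).
    have h2 := (HP N).2 y (le_lt_trans yx xN).
    by have /is_derive_eq := is_deriveB h1 h2; apply; rewrite subrr.
  have Dc A : (forall y, A y -> `|y| <= `|x|) -> {within A, continuous D}.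
    move=> Ax; apply: continuous_in_subspaceT => y; rewrite inE => /Ax yx.
    apply: differentiable_continuous; apply/derivable1_diffP.
    by have [] := DD y yx.
  have D0 : D 0 = 0 by rewrite /D (HP m).1 (HP N).1 subrr.
  suff : D x = 0 by move=> /eqP; rewrite subr_eq0 => /eqP.
  have [x0|x0] := leP 0 x.
    have [||c _] := @MVT_segment R D (fun=> 0) 0 x x0.
    - by move=> y; rewrite in_itv /= => /andP[y0 yx]; apply: DD; rewrite !ger0_norm // ltW.
    - by apply: Dc => y /=; rewrite in_itv /= => /andP[y0 yx]; rewrite !ger0_norm.
    by rewrite mul0r D0 subr0.
  have [||c _] := @MVT_segment R D (fun=> 0) x 0 (ltW x0).
  - move=> y; rewrite in_itv /= => /andP[yx y0]; apply: DD.
    by rewrite !ler0_norm ?lerN2 // ltW.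
  - apply: Dc => y /=; rewrite in_itv /= => /andP[yx y0].
    by rewrite !ler0_norm ?lerN2 // ltW.
  by rewrite mul0r D0 sub0r => /eqP; rewrite oppr_eq0 => /eqP.
pose n (x : R) := Num.truncn `|x|.
have nP (x : R) : `|x| < (n x).+1%:R by rewrite /n; exact: truncnS_gt.
exists (fun x => H (n x) x) => x.
have [_ /(_ x) HD] := HP (n x).+1.
have xn : `|x| < (n x).+2%:R by apply: lt_trans (nP x) _; rewrite ltr_nat.
have {}HD := HD xn.
apply: near_eq_is_derive HD.
have : \forall y \near x, `|y - 0| < (n x).+1%:R.
  by apply: near_ltball; rewrite subr0.
apply: filterS => y; rewrite subr0 => yn.
have yn2 : `|y| < (n x).+2%:R by apply: lt_trans yn _; rewrite ltr_nat.
have [le|lt] := leqP (n y) (n x).+1.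
  by rewrite (Hagree (n y)).
by rewrite (Hagree (n x).+1 (n y)) // ltnW.
Qed.

(** * The scalar periodic equation *)

(** A continuous T-periodic function has a T-periodic antiderivative exactly when
    its mean over a period is 0. *)
Definition balanced (R : realType) (T : R) (e : R -> R) : Prop :=
  exists2 E, primitive e E & periodic E T.

Lemma balancedD (R : realType) (T : R) (e1 e2 : R -> R) :
  balanced T e1 -> balanced T e2 -> balanced T (fun t => e1 t + e2 t).
Proof.
move=> [E1 h1 p1] [E2 h2 p2]; exists (fun t => E1 t + E2 t); first exact: primitiveD.
by move=> t; rewrite p1 p2.
Qed.

Lemma balancedZ (R : realType) (T c : R) (e : R -> R) :
  balanced T e -> balanced T (fun t => c * e t).
Proof.
move=> [E h p]; exists (fun t => c * E t); first exact: primitiveZ.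
by move=> t; rewrite p.
Qed.

Lemma balanced_eq (R : realType) (T : R) (e e' : R -> R) :
  (forall t, e t = e' t) -> balanced T e -> balanced T e'.
Proof. by move=> ee' [E h p]; exists E => //; exact: primitive_eq h. Qed.

Lemma balancedB (R : realType) (T : R) (e1 e2 : R -> R) :
  balanced T e1 -> balanced T e2 -> balanced T (fun t => e1 t - e2 t).
Proof.
move=> h1 h2; apply: (balanced_eq (e := fun t => e1 t + (-1) * e2 t)).
  by move=> t; rewrite mulN1r.
by apply: balancedD => //; exact: balancedZ.
Qed.

Lemma balanced0 (R : realType) (T : R) : balanced T (fun=> 0 : R).
Proof. by exists (fun=> 0); [exact: primitive_cst|]. Qed.

(** By Rolle's theorem for the periodic antiderivative. *)
Lemma balanced_zero (R : realType) (T t : R) (e : R -> R) : 0 < T -> balanced T e ->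
  exists s, [/\ t <= s, s <= t + T & e s = 0].
Proof.
move=> T0 [E h p].
have tT : t < t + T by rewrite ltrDl.
have [|s sI] := @MVT R E e t (t + T) tT (fun x _ => h x).
  exact/continuous_subspaceT/primitive_continuous.
rewrite p subrr => /esym/eqP; rewrite mulf_eq0 => /orP[/eqP es|].
  by exists s; move: sI; rewrite in_itv /= => /andP[/ltW ? /ltW ?]; split.
by rewrite addrAC subrr add0r gt_eqF.
Qed.

Lemma exists_mean (R : realType) (T : R) (k : R -> R) : 0 < T ->
  continuous k -> periodic k T -> exists c, balanced T (fun t => k t - c).
Proof.
move=> T0 ck pk; have [K hK] := exists_primitive ck.
have KT a b : K (a + T) - K a = K (b + T) - K b.
  apply: (primitive0_cst (K := fun t => K (t + T) - K t)).
  apply: (primitive_eq (k := fun t => k (t + T) - k t)) => [t|].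
    by rewrite pk subrr.
  exact: (primitiveB (primitive_shift T hK)).
exists ((K (0 + T) - K 0) / T); set c := _ / T.
exists (fun t => K t - c * t); first exact: (primitiveB hK (primitive_linear c)).
move=> t; rewrite mulrDr {2}/c divfK ?gt_eqF // (KT 0 t); lra.
Qed.

(** For mu = 0 a zero-mean u vanishes somewhere in each period, and the mean value
    theorem applies.  For mu <> 0 compare exp(- mu t) u(t) at t and t + T: the factor
    exp(- mu T) - 1 is not 0. *)
Lemma periodic_bound (R : realType) (T mu : R) : 0 < T ->
  exists2 C : R, 0 <= C & forall (u e : R -> R) (m : R),
    primitive (fun t => mu * u t + e t) u -> periodic u T -> balanced T u ->
    (forall t, `|e t| <= m) -> forall t, `|u t| <= C * m.
Proof.
move=> T0; have [->|mu0] := eqVneq mu 0.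
  exists T; first exact: ltW.
  move=> u e m hu pu bu em t.
  have [s [ts sT us]] := balanced_zero t T0 bu.
  have [c] := primitive_mvt s t hu; rewrite us subr0 mul0r add0r => ->.
  rewrite normrM mulrC ler_pM // distrC ger0_norm; lra.
pose q := `|expR (- mu * T) - 1|.
have q0 : 0 < q.
  rewrite normr_gt0 subr_eq0 -[X in _ != X]expR0; apply/negP => /eqP /expR_inj /eqP.
  by rewrite mulf_eq0 oppr_eq0 (negbTE mu0) gt_eqF.
exists (expR (`|mu| * T) * T / q).
  by rewrite divr_ge0 ?mulr_ge0 ?expR_ge0 ?ltW.
move=> u e m hu pu _ em t.
have hv : primitive (fun t => expR (- mu * t) * e t) (fun t => expR (- mu * t) * u t).
  apply: primitive_eq (primitiveM (primitive_expR (- mu)) hu) => s; ring.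
have tT : t <= t + T by rewrite lerDl ltW.
have [c [/andP[tc cT]]] := primitive_mvt_le hv tT.
rewrite pu addrAC subrr add0r => H.
have H' : u t * (expR (- mu * T) - 1) = expR (mu * (t - c)) * e c * T.
  have E1 : expR (- mu * (t + T)) = expR (- mu * t) * expR (- mu * T).
    by rewrite -expRD -mulrDr.
  have E2 : expR (mu * t) * expR (- mu * t) = 1.
    by rewrite -expRD mulNr subrr expR0.
  have E3 : expR (mu * (t - c)) = expR (mu * t) * expR (- mu * c).
    by rewrite -expRD; congr expR; ring.
  apply: (@etrans _ _ (expR (mu * t) * (expR (- mu * t) * expR (- mu * T) * u t - expR (- mu * t) * u t))).
    apply: (@etrans _ _ (expR (mu * t) * expR (- mu * t) * (expR (- mu * T) * u t - u t))); last by ring.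
    by rewrite E2; ring.
  by rewrite -E1 H E3; ring.
rewrite mulrAC ler_pdivlMr // -normrM H' !normrM (ger0_norm (expR_ge0 _)) (gtr0_norm T0).
rewrite -[leRHS]mulrA [T * m]mulrC mulrA ler_pM2r // ler_pM ?expR_ge0 //.
rewrite ler_expR (le_trans (ler_norm _)) // normrM ler_wpM2l //.
by rewrite distrC ger0_norm; lra.
Qed.

(** For mu = 0 subtract its mean from the antiderivative of e.  For mu <> 0 use
    variation of constants, with the initial value chosen so that
    u(T) = u(0). *)
Lemma periodic_solution (R : realType) (T mu : R) (e : R -> R) : 0 < T ->
  continuous e -> periodic e T -> balanced T e ->
  exists u, [/\ primitive (fun t => mu * u t + e t) u, periodic u T & balanced T u].
Proof.
move=> T0 ce pe be; have [E hE pE] := be; have [->|mu0] := eqVneq mu 0.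
  have [c bc] := exists_mean T0 (primitive_continuous hE) pE.
  exists (fun t => E t - c); split => //.
    apply: (primitive_eq (k := fun t => e t - 0)) => [t|]; first by rewrite mul0r add0r subr0.
    exact: (primitiveB hE (primitive_cst c)).
  by move=> t; rewrite pE.
have [v hv] : exists v, primitive (fun t => expR (- mu * t) * e t) v.
  apply: exists_primitive => t; apply: cvgM; last exact: ce.
  exact: (primitive_continuous (primitive_expR (- mu))).
have q0 : expR (mu * T) - 1 != 0.
  rewrite subr_eq0 -[X in _ != X]expR0; apply/negP => /eqP /expR_inj /eqP.
  by rewrite mulf_eq0 (negbTE mu0) gt_eqF.
(* the value of u at 0 for which u T = u 0 *)
pose c := (v 0 - expR (mu * T) * v T) / (expR (mu * T) - 1).
pose u t := expR (mu * t) * (c + v t).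
have E2 t : expR (mu * t) * expR (- mu * t) = 1.
  by rewrite -expRD mulNr subrr expR0.
have hu : primitive (fun t => mu * u t + e t) u.
  have h := primitiveM (primitive_expR mu) (primitiveD (primitive_cst c) hv).
  apply: primitive_eq h => t; rewrite /u add0r mulrA E2; ring.
have pu : periodic u T.
  (* the defect of periodicity solves the homogeneous equation *)
  pose w t := expR (- mu * t) * (u (t + T) - u t).
  have hw : primitive (fun=> 0) w.
    have h := primitiveM (primitive_expR (- mu)) (primitiveB (primitive_shift T hu) hu).
    by apply: primitive_eq h => t; rewrite pe; ring.
  have w0 : w 0 = 0.
    rewrite /w /u !mulr0 !expR0 !mul1r add0r /c; field.
    exact: q0.
  move=> t; have /eqP := primitive0_cst hw t 0.
  rewrite w0 mulf_eq0 gt_eqF ?expR_gt0 //= subr_eq0 => /eqP ->.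
  by [].
exists u; split => //.
apply: (balanced_eq (e := fun t => mu^-1 * ((mu * u t + e t) - e t))) => [t|].
  by rewrite addrK mulKf.
by apply/balancedZ/balancedB => //; exists u.
Qed.

(** * The planar linear periodic equation *)

Definition rv_primitive (R : realType) (k K : R -> 'rV[R]_2) : Prop :=
  forall i, primitive (fun t => k t 0 i) (fun t => K t 0 i).

Definition rv_balanced (R : realType) (T : R) (e : R -> 'rV[R]_2) : Prop :=
  forall i, balanced T (fun t => e t 0 i).

Lemma rvDE (R : realType) n (u v : 'rV[R]_n) i : (u + v) 0 i = u 0 i + v 0 i.
Proof. by rewrite mxE. Qed.

Lemma rvBE (R : realType) n (u v : 'rV[R]_n) i : (u - v) 0 i = u 0 i - v 0 i.
Proof. by rewrite !mxE. Qed.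

Lemma rvZE (R : realType) n (c : R) (v : 'rV[R]_n) i : (c *: v) 0 i = c * v 0 i.
Proof. by rewrite mxE. Qed.

Lemma ord2E (i : 'I_2) : i = 0 \/ i = 1.
Proof. by case: i => [[|[|//]] lt]; [left|right]; exact: val_inj. Qed.

Lemma mulmx2E (R : realType) (v : 'rV[R]_2) (A : 'M[R]_2) j :
  (v *m A) 0 j = A 0 j * v 0 0 + A 1 j * v 0 1.
Proof.
rewrite !mxE !big_ord_recl big_ord0 addr0.
have -> : lift ord0 ord0 = 1 :> 'I_2 by exact: val_inj.
by rewrite mulrC [_ * A 1 j]mulrC.
Qed.

Lemma rv_primitive_mulmx (R : realType) (k K : R -> 'rV[R]_2) (A : 'M[R]_2) :
  rv_primitive k K -> rv_primitive (fun t => k t *m A) (fun t => K t *m A).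
Proof.
move=> h j t.
have := primitiveD (primitiveZ (A 0 j) (h 0)) (primitiveZ (A 1 j) (h 1)).
by move=> /(_ t); congr is_derive; [apply/funext => s|]; rewrite mulmx2E.
Qed.

Lemma rv_balanced_mulmx (R : realType) (T : R) (e : R -> 'rV[R]_2) (A : 'M[R]_2) :
  rv_balanced T e -> rv_balanced T (fun t => e t *m A).
Proof.
move=> h j.
apply: balanced_eq (balancedD (balancedZ (A 0 j) (h 0)) (balancedZ (A 1 j) (h 1))).
by move=> t; rewrite mulmx2E.
Qed.

(** The Cayley-Hamilton identity for a 2x2 matrix of determinant 0. *)
Lemma singular_square (R : realType) (v : 'rV[R]_2) (A : 'M[R]_2) : \det A = 0 ->
  v *m A *m A = \tr A *: (v *m A).
Proof.
move=> detA.
have tA : \tr A = A 0 0 + A 1 1.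
  rewrite /mxtrace !big_ord_recl big_ord0 addr0.
  by have -> : lift ord0 ord0 = 1 :> 'I_2 by exact: val_inj.
have dA : A 0 0 * A 1 1 = A 0 1 * A 1 0.
  by move: detA; rewrite det_mx22 => /eqP; rewrite subr_eq0 => /eqP.
apply/rowP => j; rewrite [RHS]mxE !mulmx2E tA.
have [->|->] := ord2E j.
- apply: (@etrans _ _ (A 0 0 * (A 0 0 * v 0 0 + A 1 0 * v 0 1) + A 1 0 * A 1 1 * v 0 1 + A 0 1 * A 1 0 * v 0 0)); first by ring.
  by rewrite -dA; ring.
- apply: (@etrans _ _ (A 1 1 * (A 0 1 * v 0 0 + A 1 1 * v 0 1) + A 0 0 * A 0 1 * v 0 0 + A 0 1 * A 1 0 * v 0 1)); first by ring.
  by rewrite -dA; ring.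
Qed.

Lemma rv_coord_continuous (R : realType) (h : R -> 'rV[R]_2) i :
  continuous h -> continuous (fun t => h t 0 i).
Proof.
move=> ch t; apply: (@continuous_cvg _ _ _ _ _ h (fun y : 'rV[R]_2 => y 0 i)).
  exact: coord_continuous.
exact: ch.
Qed.

(** By singular_square, z = u A solves the uncoupled equations
    z' = (tr A) z + e A.  Once z is bounded, u' = z + e bounds u. *)
Lemma rv_periodic_bound (R : realType) (T : R) (A : 'M[R]_2) : 0 < T -> \det A = 0 ->
  exists2 C : R, 0 <= C & forall (u e : R -> 'rV[R]_2) (m : R),
    rv_primitive (fun t => u t *m A + e t) u -> periodic u T -> rv_balanced T u ->
    (forall t, `|e t| <= m) -> forall t, `|u t| <= C * m.
Proof.
move=> T0 detA.
have [C0 C00 HC0] := periodic_bound 0 T0.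
have [C1 C10 HC1] := periodic_bound (\tr A) T0.
exists (C0 * (C1 * (2%:R * `|A|) + 1)).
  by rewrite mulr_ge0 // addr_ge0 // mulr_ge0 // mulr_ge0.
move=> u e m hu pu bu em.
have m0 : 0 <= m by apply: le_trans (em 0).
have zle t i : `|(u t *m A) 0 i| <= C1 * (2%:R * `|A| * m).
  apply: (HC1 (fun t => (u t *m A) 0 i) (fun t => (e t *m A) 0 i)).
  - move=> s; have := rv_primitive_mulmx A hu i s; congr is_derive.
    by rewrite mulmxDl rvDE singular_square // rvZE.
  - by move=> s; rewrite pu.
  - exact: rv_balanced_mulmx.
  - move=> s; apply: le_trans (coord_le_norm _ _) _.
    by rewrite (le_trans (mulmx_norm_le _ _)) // ler_wpM2l // mulr_ge0.
move=> t; apply: norm_le_coord => [|i].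
  by rewrite mulr_ge0 // mulr_ge0 // addr_ge0 // mulr_ge0 // mulr_ge0.
rewrite -mulrA; apply: (HC0 (fun t => u t 0 i) (fun t => (u t *m A) 0 i + e t 0 i)).
- by move=> s; have := hu i s; congr is_derive; rewrite mul0r add0r rvDE.
- by move=> s; rewrite pu.
- exact: bu.
- move=> s; apply: le_trans (ler_normD _ _) _; rewrite mulrDl mul1r -mulrA lerD //.
  by apply: le_trans (coord_le_norm _ _) _.
Qed.

(** Solve z' = (tr A) z + e A and then u' = z + e coordinatewise.  That z = u A
    follows from uniqueness in the scalar equations. *)
Lemma rv_periodic_solution (R : realType) (T : R) (A : 'M[R]_2) (e : R -> 'rV[R]_2) :
  0 < T -> \det A = 0 ->
  continuous e -> periodic e T -> rv_balanced T e ->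
  exists u, [/\ rv_primitive (fun t => u t *m A + e t) u, periodic u T & rv_balanced T u].
Proof.
move=> T0 detA ce pe be; pose mu := \tr A.
have ceA : continuous (fun t => e t *m A).
  by move=> t; apply: (@continuous_comp _ _ _ e (fun v => v *m A)); [exact: ce|exact: mulmxr_continuous].
have /choice[z hz] : forall i : 'I_2, exists z : R -> R,
    [/\ primitive (fun t => mu * z t + (e t *m A) 0 i) z, periodic z T & balanced T z].
  move=> i; apply: periodic_solution => //.
  - exact: rv_coord_continuous.
  - by move=> t; rewrite pe.
  - exact: rv_balanced_mulmx.
have /choice[u hu] : forall i : 'I_2, exists u : R -> R,
    [/\ primitive (fun t => 0 * u t + (z i t + e t 0 i)) u, periodic u T & balanced T u].
  move=> i; have [h1 h2 h3] := hz i; apply: periodic_solution => //.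
  - by move=> t; apply: cvgD; [exact: (primitive_continuous h1)|exact: rv_coord_continuous].
  - by move=> t; rewrite h2 pe.
  - exact: balancedD.
pose Z t : 'rV[R]_2 := \row_i z i t; pose U t : 'rV[R]_2 := \row_i u i t.
have hZ : rv_primitive (fun t => mu *: Z t + e t *m A) Z.
  move=> i t; have [/(_ t) h _ _] := hz i; move: h; congr is_derive.
    by apply/funext => s; rewrite mxE.
  by rewrite rvDE rvZE [Z t _ _]mxE.
have hU : rv_primitive (fun t => Z t + e t) U.
  move=> i t; have [/(_ t) h _ _] := hu i; move: h; congr is_derive.
    by apply/funext => s; rewrite mxE.
  by rewrite mul0r add0r rvDE [Z t _ _]mxE.
have pZ : periodic Z T by move=> t; apply/rowP => i; rewrite !mxE; have [_ -> _] := hz i.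
have pU : periodic U T by move=> t; apply/rowP => i; rewrite !mxE; have [_ -> _] := hu i.
have bZ : rv_balanced T Z.
  by move=> i; have [_ _ h] := hz i; apply: balanced_eq h => t; rewrite mxE.
have bU : rv_balanced T U.
  by move=> i; have [_ _ h] := hu i; apply: balanced_eq h => t; rewrite mxE.
have unique0 nu (w : R -> R) : primitive (fun t => nu * w t + 0) w -> periodic w T ->
    balanced T w -> forall t, w t = 0.
  move=> h p b t; have [C _ HC] := periodic_bound nu T0.
  have := HC w (fun=> 0) 0 h p b (fun=> _) t; rewrite normr0 => /(_ (fun=> lexx _)).
  by rewrite mulr0 normr_le0 => /eqP.
(* Z takes its values in the range of A, on which A acts as mu *)
have ZA t : Z t *m A = mu *: Z t.
  apply/rowP => i; rewrite [RHS]mxE; apply/eqP; rewrite -subr_eq0; apply/eqP.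
  apply: (unique0 mu (fun t => (Z t *m A) 0 i - mu * Z t 0 i)).
  - have h := primitiveB (rv_primitive_mulmx A hZ i) (primitiveZ mu (hZ i)).
    apply: primitive_eq h => s.
    rewrite mulmxDl singular_square // -scalemxAl -/mu.
    by rewrite !rvDE !rvZE; ring.
  - by move=> s; rewrite pZ.
  - apply: balancedB; first exact: rv_balanced_mulmx.
    exact: balancedZ.
have UA t : U t *m A = Z t.
  apply/rowP => i; apply/eqP; rewrite -subr_eq0; apply/eqP.
  apply: (unique0 0 (fun t => (U t *m A) 0 i - Z t 0 i)).
  - have h := primitiveB (rv_primitive_mulmx A hU i) (hZ i).
    apply: primitive_eq h => s.
    by rewrite mulmxDl ZA mul0r addr0 subrr.
  - by move=> s; rewrite pU pZ.
  - by apply: balancedB => //; exact: rv_balanced_mulmx.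
exists U; split => //.
by move=> i t; have := hU i t; rewrite UA.
Qed.

(** * Iterated sequences of curves *)

(** Used to conclude from estimates that can be halved arbitrarily often. *)
Lemma half_expr_le0 (R : realType) (x K : R) :
  (forall n, x <= K * (1 / 2) ^+ n) -> x <= 0.
Proof.
move=> h.
have half1 : `|1 / 2 : R| < 1 by rewrite ger0_norm //; lra.
have cK := @cvg_geometric R K (1 / 2) half1.
apply: (@ler_cvg_to _ _ _ _ (fun=> x) (geometric K (1 / 2)) x 0 _ cK).
  exact: cvg_cst.
by near=> n; exact: h.
Unshelve. all: by end_near. Qed.

(** The increments are summable uniformly in t, and the tail of the geometric series
    bounds the distance to the limit. *)
Lemma geometric_limit (R : realType) (u : nat -> R -> 'rV[R]_2) (K : R) :
  (forall n t, `|u n.+1 t - u n t| <= K * (1 / 2) ^+ n) ->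
  exists v : R -> 'rV[R]_2, (forall n t, `|v t - u n t| <= 2 * K * (1 / 2) ^+ n) /\
    forall t, u n t @[n --> \oo] --> v t.
Proof.
move=> hu.
have K0 : 0 <= K by have := hu 0%N 0; rewrite expr0 mulr1; exact: le_trans.
have p0 n : 0 <= (1 / 2 : R) ^+ n by rewrite exprn_ge0 //; lra.
have dist n k t : `|u (n + k)%N t - u n t| <= 2 * K * (1 / 2) ^+ n * (1 - (1 / 2) ^+ k).
  elim: k => [|k IH]; first by rewrite addn0 subrr normr0 expr0 subrr mulr0.
  rewrite addnS -(subrK (u (n + k)%N t) (u _.+1 t)) -addrA.
  apply: le_trans (ler_normD _ _) _; apply: le_trans (lerD (hu _ _) IH) _.
  rewrite exprD [_ ^+ k.+1]exprS; lra.
have distle n m t : (n <= m)%N -> `|u m t - u n t| <= 2 * K * (1 / 2) ^+ n.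
  move=> nm; rewrite -(subnKC nm); apply: le_trans (dist _ _ _) _.
  apply: ler_piMr; first by rewrite mulr_ge0 // mulr_ge0.
  by rewrite lerBlDr lerDl.
have half1 : `|1 / 2 : R| < 1 by rewrite ger0_norm //; lra.
have cv t : cvg (u n t @[n --> \oo]).
  apply/cauchy_cvgP; apply: cauchy_exP => e e0.
  have /cvgrPdist_lt/(_ e e0) := @cvg_geometric R (2 * K) (1 / 2) half1.
  move=> [n _ Hn]; exists (u n t); exists n => // m /= nm.
  rewrite -ball_normE /= distrC; apply: le_lt_trans (distle n m t nm) _.
  have := Hn n (leqnn n); rewrite /= sub0r normrN ger0_norm //.
  by rewrite mulr_ge0 // mulr_ge0.
exists (fun t => lim (u n t @[n --> \oo])); split; last exact: cv.
move=> n t.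
have c1 : `|u m t - u n t| @[m --> \oo] --> `|lim (u n t @[n --> \oo]) - u n t|.
  by apply: cvg_norm; apply: cvgB; [exact: cv|exact: cvg_cst].
apply: (@ler_cvg_to _ _ _ _ _ (fun=> 2 * K * (1 / 2) ^+ n) _ _ c1).
  exact: cvg_cst.
by near=> m; apply: distle; near: m; exact: nbhs_infty_ge.
Unshelve. all: by end_near. Qed.

Lemma uniform_limit_cont (R : realType) (u : nat -> R -> 'rV[R]_2) (v : R -> 'rV[R]_2) (K : R) :
  (forall n, continuous (u n)) ->
  (forall n t, `|v t - u n t| <= K * (1 / 2) ^+ n) -> continuous v.
Proof.
move=> cu vu t.
have K0 : 0 <= K by have := vu 0%N 0; rewrite expr0 mulr1; exact: le_trans.
apply: (iffRL (@cvgrPdist_le R 'rV[R]_2 R (nbhs t) _ _ _)) => /= e e0.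
have half1 : `|1 / 2 : R| < 1 by rewrite ger0_norm //; lra.
have e3 : 0 < e / 3 by rewrite divr_gt0.
have /cvgrPdist_lt/(_ _ e3) := @cvg_geometric R K (1 / 2) half1.
move=> [n _ /(_ n (leqnn n))]; rewrite /= sub0r normrN ger0_norm; last first.
  by rewrite mulr_ge0 // exprn_ge0 //; lra.
move=> Kn.
have H := iffLR (@cvgrPdist_le R 'rV[R]_2 R (nbhs t) _ _ _) (cu n t) _ e3.
near=> s.
have us : `|u n t - u n s| <= e / 3 by near: s; exact: H.
rewrite (_ : v t - v s = (v t - u n t) + (u n t - u n s) + (u n s - v s)); last first.
  by rewrite !addrA !subrK.
apply: le_trans (ler_normD _ _) _.
have h1 := vu n t; have h2 := vu n s; rewrite distrC in h2.
have h3 : `|v t - u n t + (u n t - u n s)| <= `|v t - u n t| + `|u n t - u n s| by exact: ler_normD.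
lra.
Unshelve. all: by end_near. Qed.

Lemma rv_continuous_coord (R : realType) (h : R -> 'rV[R]_2) :
  (forall i, continuous (fun t => h t 0 i)) -> continuous h.
Proof.
move=> ch t; apply: (iffRL (@cvgrPdist_le R 'rV[R]_2 R (nbhs t) _ _ _)) => /= e e0.
have H i : \forall s \near t, `|h t 0 i - h s 0 i| <= e.
  by apply: (iffLR (cvgrPdist_le _ _) (ch i t)).
near=> s.
have s0 : `|h t 0 0 - h s 0 0| <= e by near: s; exact: H.
have s1 : `|h t 0 1 - h s 0 1| <= e by near: s; exact: H.
apply: norm_le_coord => [|i]; first exact: ltW.
by rewrite !mxE; have [->|->] := ord2E i.
Unshelve. all: by end_near. Qed.

Lemma rv_exists_mean (R : realType) (T : R) (k : R -> 'rV[R]_2) : 0 < T ->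
  continuous k -> periodic k T -> exists c : 'rV[R]_2, rv_balanced T (fun t => k t - c).
Proof.
move=> T0 ck pk.
have /choice[c hc] : forall i, exists c, balanced T (fun t => k t 0 i - c).
  move=> i; apply: exists_mean => //; first exact: rv_coord_continuous.
  by move=> t; rewrite pk.
exists (\row_i c i) => i; apply: balanced_eq (hc i) => t.
by rewrite rvBE [(\row_i c i) 0 i]mxE.
Qed.

(** * Lyapunov-Schmidt reduction *)

(** An a priori bound of the form m / 2 + D improves any bound m0 to 2 D. *)
Lemma halving_bound (R : realType) (d : R -> 'rV[R]_2) (m0 D : R) : 0 <= D ->
  (forall m, (forall t, `|d t| <= m) -> forall t, `|d t| <= m / 2 + D) ->
  (forall t, `|d t| <= m0) -> forall t, `|d t| <= 2 * D.
Proof.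
move=> D0 hd h0 t.
have H n : forall t, `|d t| <= m0 * (1 / 2) ^+ n + 2 * D.
  elim: n => [|n IH] s; first by rewrite expr0 mulr1 ler_wpDr ?mulr_ge0.
  apply: le_trans (hd _ IH s) _; rewrite exprS; lra.
suff : `|d t| - 2 * D <= 0 by rewrite subr_le0.
by apply: (half_expr_le0 (K := m0)) => n; rewrite lerBlDr.
Qed.

(** One step of the iteration: the forcing is evaluated along the curve a + u, and
    the constant c makes it of zero mean, so that w exists. *)
Definition ls_step (R : realType) (T : R) (A : 'M[R]_2) (N : R -> R -> 'rV[R]_2 -> 'rV[R]_2)
    (l : R) (a : 'rV[R]_2) (u w : R -> 'rV[R]_2) (c : 'rV[R]_2) : Prop :=
  [/\ rv_primitive (fun t => w t *m A + (N l t (a + u t) - c)) w,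
      periodic w T & rv_balanced T w].

Section LyapunovSchmidt.
Context (R : realType) (T : R) (A : 'M[R]_2) (N : R -> R -> 'rV[R]_2 -> 'rV[R]_2).
Context (C eps L B : R).
Context (T_gt0 : 0 < T) (detA : \det A = 0) (C_ge0 : 0 <= C) (L_ge0 : 0 <= L).
Context (C_bound : forall (u e : R -> 'rV[R]_2) (m : R),
    rv_primitive (fun t => u t *m A + e t) u -> periodic u T -> rv_balanced T u ->
    (forall t, `|e t| <= m) -> forall t, `|u t| <= C * m).
Context (eps_gt0 : 0 < eps) (C_eps : 4 * C * eps <= 1).
Context (N_cont : forall l (x : R -> 'rV[R]_2), continuous x ->
   continuous (fun t => N l t (x t))).
Context (N_per : forall l t x, N l (t + T) x = N l t x).
Context (N_lip : forall l l' t x x',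
   `|N l t x - N l' t x'| <= eps * `|x - x'| + L * `|l - l'|).
Context (N_bound : forall l t x, `|N l t x| <= B).

Local Notation step := (ls_step T A N).

(** A zero-mean coordinate of e - c vanishes at some time, where c takes the value of
    e. *)
Lemma step_mean (w e : R -> 'rV[R]_2) (c : 'rV[R]_2) (m : R) : 0 <= m ->
  rv_primitive (fun t => w t *m A + (e t - c)) w -> periodic w T -> rv_balanced T w ->
  (forall t, `|e t| <= m) -> `|c| <= m.
Proof.
move=> m0 hw pw bw em; apply: norm_le_coord => // i.
have b1 : balanced T (fun t => (w t *m A + (e t - c)) 0 i).
  by exists (fun t => w t 0 i); [exact: hw|move=> t; rewrite pw].
have b2 : balanced T (fun t => (e t - c) 0 i).
  apply: balanced_eq (balancedB b1 (rv_balanced_mulmx A bw i)) => t.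
  by rewrite !rvDE; ring.
have [s [_ _]] := balanced_zero 0 T_gt0 b2.
rewrite rvBE => /eqP; rewrite subr_eq0 => /eqP <-.
exact: le_trans (coord_le_norm _ _) (em s).
Qed.

Lemma step_exists l a (u : R -> 'rV[R]_2) : continuous u -> periodic u T ->
  exists w c, step l a u w c.
Proof.
move=> cu pu; pose k t := N l t (a + u t).
have ck : continuous k.
  by apply: N_cont => t; apply: (@cvgD _ _ _ (nbhs t)); [exact: cvg_cst|exact: cu].
have pk : periodic k T by move=> t; rewrite /k N_per pu.
have [c bc] := rv_exists_mean T_gt0 ck pk.
have [||w [h1 h2 h3]] := @rv_periodic_solution R T A (fun t => k t - c) T_gt0 detA _ _ bc.
- by move=> t; apply: (@cvgB _ _ _ (nbhs t)); [exact: ck|exact: cvg_cst].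
- by move=> t; rewrite pk.
by exists w, c.
Qed.

Lemma step_bound l a u w c : step l a u w c ->
  (forall t, `|w t| <= C * (2 * B)).
Proof.
move=> [hw pw bw]; have B0 : 0 <= B := le_trans (normr_ge0 _) (N_bound 0 0 0).
have cB : `|c| <= B by apply: step_mean hw pw bw _ => // t; exact: N_bound.
apply: C_bound hw pw bw _ => t.
by apply: le_trans (ler_normB _ _) _; have := N_bound l t (a + u t); lra.
Qed.

(** The contraction estimate, uniform in the parameter l and the mean value a. *)
Lemma step_diff l1 a1 u1 w1 c1 l2 a2 u2 w2 c2 m :
  step l1 a1 u1 w1 c1 -> step l2 a2 u2 w2 c2 ->
  (forall t, `|u1 t - u2 t| <= m) ->
  let D := eps * `|a1 - a2| + L * `|l1 - l2| in
  (forall t, `|w1 t - w2 t| <= m / 2 + C * (2 * D)) /\ `|c1 - c2| <= eps * m + D.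
Proof.
move=> [hw1 pw1 bw1] [hw2 pw2 bw2] um D.
have m0 : 0 <= m := le_trans (normr_ge0 _) (um 0).
have D0 : 0 <= D by rewrite addr_ge0 // mulr_ge0 // ltW.
pose w t := w1 t - w2 t; pose c := c1 - c2.
pose k t := N l1 t (a1 + u1 t) - N l2 t (a2 + u2 t).
have hw : rv_primitive (fun t => w t *m A + (k t - c)) w.
  move=> i t; have := primitiveB (hw1 i) (hw2 i) t; congr is_derive.
    by apply/funext => s; rewrite rvBE.
  by rewrite /k /w /c mulmxBl !(rvBE, rvDE); ring.
have pw : periodic w T by move=> t; rewrite /w pw1 pw2.
have bw : rv_balanced T w.
  by move=> i; apply: balanced_eq (balancedB (bw1 i) (bw2 i)) => t; rewrite rvBE.
have kle t : `|k t| <= eps * m + D.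
  apply: le_trans (N_lip _ _ _ _ _) _; rewrite /D addrA lerD2r -mulrDr.
  rewrite ler_pM2l // opprD addrACA; apply: le_trans (ler_normD _ _) _.
  by have := um t; lra.
have mD : 0 <= eps * m + D by rewrite addr_ge0 // mulr_ge0 // ltW.
have cle : `|c| <= eps * m + D by apply: step_mean hw pw bw kle.
split => // t.
apply: le_trans (C_bound hw pw bw (m := 2 * (eps * m + D)) _ t) _ => [s|].
  by apply: le_trans (ler_normB _ _) _; have := kle s; lra.
have : 4 * C * eps * m <= 1 * m by rewrite ler_wpM2r.
by lra.
Qed.

Lemma fixed_point_exists l a :
  exists u c, continuous u /\ step l a u u c.
Proof.
have /choice[W HW] : forall u : R -> 'rV[R]_2, exists w, continuous u /\ periodic u T ->
    exists c, step l a u w c.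
  move=> u; have [[cu pu]|h] := pselect (continuous u /\ periodic u T).
    by have [w wP] := step_exists l a cu pu; exists w.
  by exists u => /h.
have Wc (u : R -> 'rV[R]_2) : continuous u /\ periodic u T -> continuous (W u) /\ periodic (W u) T.
  move=> /HW[c [h p _]]; split=> //.
  by apply: rv_continuous_coord => i; exact: primitive_continuous (h i).
pose u n := iter n W (fun=> 0).
have cu n : continuous (u n) /\ periodic (u n) T.
  elim: n => [|n IH]; last exact: Wc.
  by split => [t|t]; [exact: cvg_cst|].
have us n : exists c, step l a (u n) (u n.+1) c by exact: HW (cu n).
have incr n t : `|u n.+1 t - u n t| <= C * (2 * B) * (1 / 2) ^+ n.
  elim: n t => [|n IH] t.
    have [c /step_bound h] := us 0%N.
    by rewrite expr0 mulr1 subr0; exact: h.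
  have [c1 s1] := us n; have [c2 s2] := us n.+1.
  have [+ _] := step_diff s2 s1 IH; rewrite !subrr !normr0 !mulr0 addr0 !mulr0 addr0.
  move=> /(_ t) h; apply: le_trans h _; rewrite exprS; lra.
have [v [vu cv]] := geometric_limit incr.
have cont_v : continuous v by apply: uniform_limit_cont vu => n; have [] := cu n.
have per_v : periodic v T.
  move=> t; apply: (@cvg_unique _ (@norm_hausdorff _ _) (u n t @[n --> \oo])); last exact: cv.
  have -> : (fun n => u n t) = (fun n => u n (t + T)).
    by apply/funext => n; have [_ ->] := cu n.
  exact: cv.
have [c sc] := HW v (conj cont_v per_v).
exists v, c; split => //; suff Wv : W v = v by move: sc; rewrite Wv.
have B0 : 0 <= B := le_trans (normr_ge0 _) (N_bound 0 0 0).
apply/funext => t; apply/eqP; rewrite -subr_eq0 -normr_le0.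
apply: (half_expr_le0 (K := 2 * (2 * (C * (2 * B))))) => n.
have [c' s'] := us n.
have [+ _] := step_diff sc s' (vu n).
rewrite !subrr !normr0 !mulr0 addr0 !mulr0 addr0 => /(_ t) h.
rewrite -(subrK (u n.+1 t) (W v t)) -addrA; apply: le_trans (ler_normD _ _) _.
have := vu n.+1 t; rewrite distrC exprS => h'.
have : 0 <= C * (2 * B) * (1 / 2) ^+ n.
  by rewrite mulr_ge0 ?exprn_ge0 ?mulr_ge0 //; lra.
lra.
Qed.

Lemma fixed_point_lip l1 a1 u1 c1 l2 a2 u2 c2 :
  step l1 a1 u1 u1 c1 -> step l2 a2 u2 u2 c2 ->
  let D := eps * `|a1 - a2| + L * `|l1 - l2| in
  (forall t, `|u1 t - u2 t| <= 2 * (C * (2 * D))) /\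
  `|c1 - c2| <= eps * (2 * (C * (2 * D))) + D.
Proof.
move=> s1 s2 D.
have D0 : 0 <= D by rewrite addr_ge0 // mulr_ge0 // ltW.
have E : forall t, `|u1 t - u2 t| <= 2 * (C * (2 * D)).
  apply: (@halving_bound _ _ (C * (2 * B) + C * (2 * B))).
  - by rewrite mulr_ge0 // mulr_ge0.
  - by move=> m hm; have [+ _] := step_diff s1 s2 hm; exact.
  - move=> t; apply: le_trans (ler_normB _ _) _.
    by apply: lerD; [exact: (step_bound s1)|exact: (step_bound s2)].
by split => //; have [_ ] := step_diff s1 s2 E.
Qed.

End LyapunovSchmidt.

(** For a forcing N with small Lipschitz constant, each mean value a determines a
    zero-mean correction u and the constant c by which a + u fails to solve the
    equation.  The threshold eps depends on T and A only, so that N can be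
    localized afterwards. *)
Lemma lyapunov_schmidt (R : realType) (T : R) (A : 'M[R]_2) :
  0 < T -> \det A = 0 ->
  exists2 eps : R, 0 < eps &
  forall (N : R -> R -> 'rV[R]_2 -> 'rV[R]_2) (L B : R), 0 <= L ->
  (forall l (x : R -> 'rV[R]_2), continuous x -> continuous (fun t => N l t (x t))) ->
  (forall l t x, N l (t + T) x = N l t x) ->
  (forall l l' t x x',
     `|N l t x - N l' t x'| <= eps * `|x - x'| + L * `|l - l'|) ->
  (forall l t x, `|N l t x| <= B) ->
  exists (u : R -> 'rV[R]_2 -> R -> 'rV[R]_2) (c : R -> 'rV[R]_2 -> 'rV[R]_2) (K : R),
  [/\ forall l a, continuous (u l a),
     forall l a, ls_step T A N l a (u l a) (u l a) (c l a),
     forall l a l' a' t, `|u l a t - u l' a' t| <= K * (`|a - a'| + `|l - l'|),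
     forall l a l' a', `|c l a - c l' a'| <= K * (`|a - a'| + `|l - l'|)
   & forall l a v d, ls_step T A N l a v v d -> v = u l a /\ d = c l a].
Proof.
move=> T0 detA; have [C C0 HC] := rv_periodic_bound T0 detA.
(* a step then contracts by 2 * C * eps <= 1 / 2 *)
pose eps := (4 * (C + 1))^-1.
have C4 : 0 < 4 * (C + 1) by rewrite mulr_gt0 //; lra.
have eps0 : 0 < eps by rewrite invr_gt0.
have Ceps : 4 * C * eps <= 1.
  by rewrite /eps ler_pdivrMr // mul1r; lra.
exists eps => // N L B L0 Nc Np Nl Nb.
have HE := fixed_point_exists T0 detA C0 L0 HC eps0 Ceps Nc Np Nl Nb.
have HL := fixed_point_lip T0 C0 L0 HC eps0 Ceps Nl Nb.
have /choice[u /choice[c uc]] : forall la : R * 'rV[R]_2, exists u : R -> 'rV[R]_2,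
    exists c, continuous u /\ ls_step T A N la.1 la.2 u u c.
  by move=> [l a]; exact: HE.
pose K := 4 * C * (eps + L) + (eps + L) * (eps * (4 * C) + 1).
have K1 x y : 0 <= x -> 0 <= y ->
    2 * (C * (2 * (eps * x + L * y))) <= K * (x + y) /\
    eps * (2 * (C * (2 * (eps * x + L * y)))) + (eps * x + L * y) <= K * (x + y).
  move=> x0 y0; set D := eps * x + L * y.
  have D0 : 0 <= D by rewrite addr_ge0 // mulr_ge0 // ltW.
  have e0 : 0 <= eps by exact: ltW.
  have C40 : 0 <= C * 4 by rewrite mulr_ge0.
  have xy : 0 <= (eps + L) * (x + y) by rewrite mulr_ge0 ?addr_ge0.
  have DD : D <= (eps + L) * (x + y).
    have := mulr_ge0 e0 y0; have := mulr_ge0 L0 x0; rewrite /D; lra.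
  have h1 : C * 4 * D <= C * 4 * ((eps + L) * (x + y)) by rewrite ler_wpM2l.
  have h2 : eps * (C * 4 * D) <= eps * (C * 4 * ((eps + L) * (x + y))) by rewrite ler_wpM2l.
  have h3 : 0 <= C * 4 * ((eps + L) * (x + y)) by rewrite mulr_ge0.
  have h4 : 0 <= eps * (C * 4 * ((eps + L) * (x + y))) by rewrite mulr_ge0.
  have KE : K * (x + y) = C * 4 * ((eps + L) * (x + y)) +
     eps * (C * 4 * ((eps + L) * (x + y))) + (eps + L) * (x + y) by rewrite /K; ring.
  by rewrite KE; split; lra.
exists (fun l a => u (l, a)), (fun l a => c (l, a)), K; split.
- by move=> l a; have [] := uc (l, a).
- by move=> l a; have [] := uc (l, a).
- move=> l a l' a' t; have [_ s1] := uc (l, a); have [_ s2] := uc (l', a').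
  have [h _] := HL _ _ _ _ _ _ _ _ s1 s2; apply: le_trans (h t) _.
  by have [] := K1 `|a - a'| `|l - l'| (normr_ge0 _) (normr_ge0 _).
- move=> l a l' a'; have [_ s1] := uc (l, a); have [_ s2] := uc (l', a').
  have [_ h] := HL _ _ _ _ _ _ _ _ s1 s2; apply: le_trans h _.
  by have [] := K1 `|a - a'| `|l - l'| (normr_ge0 _) (normr_ge0 _).
- move=> l a v d s1; have [_ s2] := uc (l, a).
  have [h1 h2] := HL _ _ _ _ _ _ _ _ s1 s2.
  rewrite /= !subrr !normr0 !mulr0 addr0 !mulr0 in h1 h2.
  rewrite addr0 in h2.
  split; last by apply/eqP; rewrite -subr_eq0 -normr_le0.
  by apply/funext => t; apply/eqP; rewrite -subr_eq0 -normr_le0; exact: h1.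
Qed.

(** * Mean value inequality and periodic fields *)

(** The difference quotients coincide.  This turns derivatives along segments and
    partial derivatives into directional derivatives. *)
Lemma is_derive_line (R : realType) (V V' W : normedModType R) (f : V -> W) (g : V' -> W)
    (a v : V) (a' v' : V') (d : W) :
  (forall h : R, f (h *: v + a) = g (h *: v' + a')) ->
  is_derive a v f d -> is_derive a' v' g d.
Proof.
move=> fg [df dfE].
have fa : f a = g a' by have := fg 0; rewrite !scale0r !add0r.
have E : (fun h : R => h^-1 *: ((f \o shift a) (h *: v) - f a)) =
         (fun h : R => h^-1 *: ((g \o shift a') (h *: v') - g a')).
  by apply/funext => h /=; rewrite fg fa.
by split; [rewrite /derivable -E|rewrite /derive -E].
Qed.

Lemma is_derive_diff (R : realType) (V W : normedModType R) (f : V -> W) (a v : V) :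
  differentiable f a -> is_derive a v f ('d f a v).
Proof. by move=> df; split; [exact: diff_derivable|exact: deriveE]. Qed.

Lemma is_derive_coord (R : realType) (V : normedModType R) n (f : V -> 'rV[R]_n)
    (a v : V) (d : 'rV[R]_n) (i : 'I_n) :
  is_derive a v f d -> is_derive a v (fun x => f x 0 i) (d 0 i).
Proof.
move=> [df dE]; split; first by move/derivable_mxP : df; exact.
by rewrite -dE derive_mx // mxE.
Qed.

Lemma is_derive_rV (R : realType) (V : normedModType R) n (f : V -> 'rV[R]_n)
    (a v : V) (d : 'rV[R]_n) :
  (forall i, is_derive a v (fun x => f x 0 i) (d 0 i)) -> is_derive a v f d.
Proof.
move=> h; have df : derivable f a v.
  by apply/derivable_mxP => i j; rewrite (ord1 i); have [] := h j.
split => //; rewrite derive_mx //; apply/rowP => i; rewrite mxE.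
by have [_ ->] := h i.
Qed.

Lemma is_derive_mulmxr (R : realType) n (A : 'M[R]_n) (p a v : 'rV[R]_n) :
  is_derive a v (fun q : 'rV[R]_n => (q - p) *m A) (v *m A).
Proof.
pose l (t : R) : 'rV[R]_n := t *: (v *m A) + (a - p) *m A.
have dl : is_derive (0 : R) (1 : R) l (v *m A).
  apply: is_derive_rV => i.
  have := primitiveD (primitive_linear ((v *m A) 0 i))
     (primitive_cst (((a - p) *m A) 0 i)) 0.
  rewrite addr0; congr is_derive; apply/funext => t.
  by rewrite /l rvDE rvZE mulrC.
apply: is_derive_line dl => h.
by rewrite /l addr0 [h *: 1]mulr1 -[_ + a - p]addrA [RHS]mulmxDl -scalemxAl.
Qed.

Lemma mean_value_ineq (R : realType) n m (H : 'rV[R]_n -> 'rV[R]_m)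
    (dH : 'rV[R]_n -> 'rV[R]_n -> 'rV[R]_m) (p x y : 'rV[R]_n) (r K : R) :
  0 <= K ->
  (forall q v, `|q - p| <= r -> is_derive q v H (dH q v)) ->
  (forall q v, `|q - p| <= r -> `|dH q v| <= K * `|v|) ->
  `|x - p| <= r -> `|y - p| <= r -> `|H x - H y| <= K * `|x - y|.
Proof.
move=> K0 hH hK xr yr; apply: norm_le_coord => [|i]; first by rewrite mulr_ge0.
pose q (s : R) := s *: (x - y) + y.
have qr (s : R) : 0 <= s <= 1 -> `|q s - p| <= r.
  move=> /andP[s0 s1].
  have -> : q s - p = s *: (x - p) + (1 - s) *: (y - p).
    rewrite /q !scalerBr !scalerBl !scale1r.
    by apply/rowP => j; rewrite !mxE; ring.
  apply: le_trans (ler_normD _ _) _; rewrite !normrZ !ger0_norm //; last by lra.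
  apply: (@le_trans _ _ (s * r + (1 - s) * r)); last by lra.
  by apply: lerD; apply: ler_wpM2l => //; lra.
have dq (s : R) : 0 <= s <= 1 ->
    is_derive s (1 : R) (fun s : R => H (q s) 0 i) (dH (q s) (x - y) 0 i).
  move=> s01; apply: is_derive_coord.
  apply: is_derive_line (hH (q s) (x - y) (qr s s01)) => h.
  by rewrite /q scalerDl addrA [h *: 1]mulr1.
have cq : {within `[0, 1], continuous (fun s : R => H (q s) 0 i)}.
  apply: continuous_in_subspaceT => s; rewrite inE /= in_itv /= => s01.
  apply: differentiable_continuous; apply/derivable1_diffP.
  by have [] := dq s s01.
have [|c cI] := @MVT_segment R (fun s => H (q s) 0 i) (fun s => dH (q s) (x - y) 0 i) 0 1 ler01 _ cq.
  by move=> s; rewrite in_itv /= => /andP[s0 s1]; apply: dq; rewrite !ltW.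
rewrite subr0 mulr1 /q scale1r scale0r add0r subrK => E.
rewrite rvBE E; apply: le_trans (coord_le_norm _ _) _.
by apply: hK; apply: qr; rewrite in_itv in cI.
Qed.

Lemma additive_norm_le (R : realType) (W : normedModType R) n (phi : 'rV[R]_n -> W)
    (m : R) (v : 'rV[R]_n) :
  (forall u w, phi (u + w) = phi u + phi w) -> (forall c u, phi (c *: u) = c *: phi u) ->
  (forall i, `|phi (delta_mx 0 i)| <= m) -> `|phi v| <= n%:R * m * `|v|.
Proof.
move=> phiD phiZ hm; rewrite {1}(row_sum_delta v).
have phi0 : phi 0 = 0 by rewrite -(scale0r 0) phiZ scale0r.
rewrite (big_morph phi phiD phi0); apply: le_trans (ler_norm_sum _ _ _) _.
apply: (@le_trans _ _ (\sum_(i < n) (m * `|v|))).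
  apply: ler_sum => i _; rewrite phiZ normrZ mulrC ler_pM //.
  exact: coord_le_norm.
by rewrite sumr_const card_ord -[_ *+ n]mulr_natl mulrA.
Qed.

Lemma periodic_reduce (R : realType) (T : R) (t : R) : 0 < T ->
  exists s : R, 0 <= s <= T /\ forall (X : Type) (f : R -> X),
    (forall u, f (u + T) = f u) -> f t = f s.
Proof.
move=> T0; pose k := Num.floor (t / T).
exists (t - k%:~R * T); split.
  have k1 : k%:~R <= t / T by exact: floor_le.
  have k2 : t / T < (k + 1)%:~R by exact: floorD1_gt.
  rewrite ler_pdivlMr // in k1; rewrite ltr_pdivrMr // intrD mulrDl mul1r in k2.
  by apply/andP; split; lra.
move=> X f pf.
have pn n u : f (u + n%:R * T) = f u.
  elim: n => [|n IH]; first by rewrite mul0r addr0.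
  by rewrite -natr1 mulrDl mul1r addrA pf.
case: k => n.
  by rewrite -[RHS](pn n) subrK.
rewrite NegzE mulrNz mulNr opprK; exact/esym/pn.
Qed.

(** * Localization of the vector fields *)

Definition clampr (R : realType) (a b x : R) : R := Num.max a (Num.min b x).

Definition clamp (R : realType) n (p : 'rV[R]_n) (r : R) (x : 'rV[R]_n) : 'rV[R]_n :=
  \row_i clampr (p 0 i - r) (p 0 i + r) (x 0 i).

Lemma clampr_lip (R : realType) (a b x y : R) : `|clampr a b x - clampr a b y| <= `|x - y|.
Proof.
wlog xy : x y / x <= y => [WL|].
  have [xy|/ltW yx] := leP x y; first exact: WL.
  by rewrite distrC [leRHS]distrC; exact: WL.
have H : clampr a b x <= clampr a b y /\ clampr a b y - clampr a b x <= y - x.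
  by rewrite /clampr /Num.max /Num.min; do !case: ifPn; rewrite -?leNgt; lra.
rewrite distrC [leRHS]distrC !ger0_norm; lra.
Qed.

Lemma clampr_bound (R : realType) (a b x : R) : a <= b -> a <= clampr a b x <= b.
Proof.
move=> ab; rewrite /clampr le_max lexx /= ge_max ab /= ge_min lexx //.
Qed.

Lemma clampr_id (R : realType) (a b x : R) : a <= x <= b -> clampr a b x = x.
Proof.
by move=> /andP[ax xb]; rewrite /clampr min_r // max_r.
Qed.

Lemma clamp_bound (R : realType) n (p x : 'rV[R]_n) (r : R) : 0 <= r ->
  `|clamp p r x - p| <= r.
Proof.
move=> r0; apply: norm_le_coord => // i; rewrite rvBE mxE ler_norml.
have [] := andP (@clampr_bound R (p 0 i - r) (p 0 i + r) (x 0 i) _); first by lra.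
by move=> h1 h2; apply/andP; split; lra.
Qed.

Lemma clamp_id (R : realType) n (p x : 'rV[R]_n) (r : R) :
  `|x - p| <= r -> clamp p r x = x.
Proof.
move=> xr; apply/rowP => i; rewrite mxE clampr_id //.
have := le_trans (coord_le_norm (x - p) i) xr; rewrite rvBE ler_norml => /andP[h1 h2].
by apply/andP; split; lra.
Qed.

Lemma clamp_lip (R : realType) n (p x y : 'rV[R]_n) (r : R) :
  `|clamp p r x - clamp p r y| <= `|x - y|.
Proof.
apply: norm_le_coord => // i; rewrite rvBE !mxE.
by apply: le_trans (clampr_lip _ _ _ _) _; rewrite -rvBE; exact: coord_le_norm.
Qed.

Lemma clamp_continuous (R : realType) n (p : 'rV[R]_n) (r : R) :
  continuous (clamp p r).
Proof.
move=> x; apply: (iffRL (@cvgrPdist_le R 'rV[R]_n 'rV[R]_n (nbhs x) _ _ _)) => /= e e0.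
near=> y; apply: le_trans (clamp_lip _ _ _ _) _; near: y.
exact: cvgr_dist_le.
Unshelve. all: by end_near. Qed.

Lemma compact_image_bound (R : realType) (X : topologicalType) (V : normedModType R)
    (K : set X) (phi : X -> V) : compact K -> continuous phi ->
  exists2 M : R, 0 <= M & forall z, K z -> `|phi z| <= M.
Proof.
move=> cK cphi.
have /compact_bounded[M [_ HM]] : compact (phi @` K).
  by apply: continuous_compact => //; exact: continuous_subspaceT.
exists (`|M| + 1); first by rewrite addr_ge0.
by move=> z Kz; apply: (HM (`|M| + 1)); [have := ler_norm M; lra|exists z].
Qed.

(** Continuity on the compact set of times in [0, T] and positions in the ball; all
    other times reduce to these by periodicity. *)
Lemma periodic_field_bounds (R : realType) (T : R) (f : R -> 'rV[R]_2 -> 'rV[R]_2)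
    (p : 'rV[R]_2) (r : R) :
  0 < T -> C1 (fun z : R * 'rV[R]_2 => f z.1 z.2) -> (forall x, periodic (f ^~ x) T) ->
  exists M K : R, [/\ 0 <= M, 0 <= K,
    forall t x, `|x - p| <= r -> `|f t x| <= M
  & forall t x y, `|x - p| <= r -> `|y - p| <= r -> `|f t x - f t y| <= K * `|x - y| ].
Proof.
move=> T0 [dF cdF] pf; set F := fun z : R * 'rV[R]_2 => f z.1 z.2 in dF cdF.
pose Q : set (R * 'rV[R]_2) := `[0, T] `*` [set x | `|x - p| <= r].
have cQ : compact Q.
  by apply: compact_setX; [exact: segment_compact|exact: closed_box_compact].
have [M M0 HM] : exists2 M : R, 0 <= M & forall z, Q z -> `|F z| <= M.
  by apply: compact_image_bound => // z; exact: differentiable_continuous.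
have [K0 K00 HK0] := compact_image_bound cQ (cdF (0, delta_mx 0 0)).
have [K1 K10 HK1] := compact_image_bound cQ (cdF (0, delta_mx 0 1)).
have reduce t : exists s : R, 0 <= s <= T /\ f t = f s.
  have [s [sT hs]] := periodic_reduce t T0; exists s; split => //.
  by apply: hs => u; apply/funext => x; exact: pf.
exists M, (2%:R * (K0 + K1)); split => //.
- by rewrite mulr_ge0 // addr_ge0.
- move=> t x xr; have [s [sT ->]] := reduce t.
  by apply: (HM (s, x)); split => //=; rewrite in_itv.
- move=> t x y; have [s [sT ->]] := reduce t.
  apply: (@mean_value_ineq _ _ _ (f s) (fun q v => 'd F (s, q) (0, v)) p).
  + by rewrite mulr_ge0 // addr_ge0.
  + move=> q v _; apply: is_derive_line (is_derive_diff (0, v) (dF (s, q))) => h.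
    by rewrite /F /= scaler0 add0r.
  + move=> q v qr; apply: (@additive_norm_le _ _ _ (fun v => 'd F (s, q) (0, v))).
    * by move=> u w; rewrite -linearD; congr ('d F _ _); congr pair; rewrite addr0.
    * by move=> c u; rewrite -linearZ; congr ('d F _ _); congr pair; rewrite scaler0.
    * have Qq : Q (s, q) by split => //=; rewrite in_itv.
      move=> i; have [->|->] := ord2E i.
        by apply: le_trans (HK0 _ Qq) _; rewrite lerDl.
      by apply: le_trans (HK1 _ Qq) _; rewrite lerDr.
Qed.

(** The derivative of the remainder of g vanishes at p and is continuous. *)
Lemma linearization_lip (R : realType) (g : 'rV[R]_2 -> 'rV[R]_2) (p : 'rV[R]_2) (e : R) :
  C1 g -> 0 < e ->
  \forall r \near (0 : R)^'+, forall x y, `|x - p| <= r -> `|y - p| <= r ->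
    `|(g x - (x - p) *m 'J g p) - (g y - (y - p) *m 'J g p)| <= e * `|x - y|.
Proof.
move=> [dg cdg] e0; pose A := 'J g p.
have e2 : 0 < e / 2 by rewrite divr_gt0.
have near_d (i : 'I_2) : \forall q \near p, `|'d g q (delta_mx 0 i) - 'd g p (delta_mx 0 i)| <= e / 2.
  have := iffLR (@cvgrPdist_le R 'rV[R]_2 'rV[R]_2 (nbhs p) _ _ _) (cdg (delta_mx 0 i) p) _ e2.
  by move=> H; near=> q; rewrite distrC; near: q; exact: H.
near=> r => x y.
have H i q : `|q - p| <= r -> `|'d g q (delta_mx 0 i) - 'd g p (delta_mx 0 i)| <= e / 2.
  move: i q; have h0 : forall q, `|q - p| <= r -> `|'d g q (delta_mx 0 0) - 'd g p (delta_mx 0 0)| <= e / 2.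
    by near: r; exact: nbhs_closed_ball_le (near_d 0).
  have h1 : forall q, `|q - p| <= r -> `|'d g q (delta_mx 0 1) - 'd g p (delta_mx 0 1)| <= e / 2.
    by near: r; exact: nbhs_closed_ball_le (near_d 1).
  by move=> i q; have [->|->] := ord2E i; [exact: h0|exact: h1].
apply: (@mean_value_ineq _ _ _ (fun q => g q - (q - p) *m A)
  (fun q v => 'd g q v - v *m A)); first exact: ltW.
- move=> q v _; apply: is_deriveB; last exact: is_derive_mulmxr.
  exact: is_derive_diff.
- move=> q v qr; rewrite -[leRHS](_ : 2%:R * (e / 2) * `|v| = _); last by field.
  apply: (@additive_norm_le _ _ _ (fun v => 'd g q v - v *m A)).
  + by move=> u w; rewrite linearD mulmxDl opprD addrACA.
  + by move=> c u; rewrite linearZ -scalemxAl scalerBr.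
  + by move=> i; rewrite /A -diffE_jacobian; exact: H.
Unshelve. all: by end_near. Qed.

(** * A forcing term with small Lipschitz constant *)

(** Positions are clamped to a small ball around p, where the remainder of g has a
    small Lipschitz constant, and the parameter to a short interval [0, l0], where
    l f has one.  Inside these ranges the equation is unchanged. *)
Lemma localized_forcing (R : realType) (T eps r1 : R) (g : 'rV[R]_2 -> 'rV[R]_2)
    (f : R -> 'rV[R]_2 -> 'rV[R]_2) (p : 'rV[R]_2) (A := 'J g p) :
  0 < T -> 0 < eps -> 0 < r1 -> C1 g -> C1 (fun z : R * 'rV[R]_2 => f z.1 z.2) ->
  (forall x, periodic (f ^~ x) T) -> g p = 0 ->
  exists (r l0 L B : R) (N : R -> R -> 'rV[R]_2 -> 'rV[R]_2),
  [/\ 0 < r <= r1, 0 < l0, 0 <= L &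
  [/\ forall l (x : R -> 'rV[R]_2), continuous x -> continuous (fun t => N l t (x t)),
     forall l t x, N l (t + T) x = N l t x,
     forall l l' t x x',
       `|N l t x - N l' t x'| <= eps * `|x - x'| + L * `|l - l'|,
     forall l t x, `|N l t x| <= B &
     (forall t t' x, N 0 t x = N 0 t' x) /\
     forall l t x, 0 <= l <= l0 -> `|x - p| <= r ->
       N l t x = g x - (x - p) *m A + l *: f t x]].
Proof.
move=> T0 e0 r10 gC1 fC1 pf gp.
have e2 : 0 < eps / 2 by rewrite divr_gt0.
have [r [r0 rr1 hlip]] : exists r : R, [/\ 0 < r, r <= r1 &
   forall x y, `|x - p| <= r -> `|y - p| <= r ->
    `|(g x - (x - p) *m A) - (g y - (y - p) *m A)| <= eps / 2 * `|x - y|].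
  near (0 : R)^'+ => r; exists r; split => //.
    by near: r; apply: nbhs_right_le.
  by near: r; exact: linearization_lip.
have [M [K [M0 K0 fM fK]]] := periodic_field_bounds p r T0 fC1 pf.
pose l0 := eps / (2 * (K + 1)).
have K2 : 0 < 2 * (K + 1) by rewrite mulr_gt0 //; lra.
have l00 : 0 < l0 by rewrite divr_gt0.
have l0K : l0 * K <= eps / 2.
  have -> : l0 * K = (eps / 2) * (K / (K + 1)).
    by rewrite /l0; field; rewrite gt_eqF //; lra.
  by apply: ler_piMr; [exact: ltW|rewrite ler_pdivrMr; lra].
pose h x := g x - (x - p) *m A.
have hp : h p = 0 by rewrite /h gp subrr mul0mx subrr.
pose q := clamp p r.
have qr x : `|q x - p| <= r by apply: clamp_bound; exact: ltW.
have pr : `|p - p| <= r by rewrite subrr normr0 ltW.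
pose cl := clampr 0 l0.
have cl0 l : 0 <= cl l <= l0 by apply: clampr_bound; exact: ltW.
exists r, l0, M, (eps / 2 * r + l0 * M), (fun l t x => h (q x) + cl l *: f t (q x)).
split => //; first by rewrite r0.
split.
- move=> l x cx t.
  have cq : {for t, continuous (fun t => q (x t))}.
    by apply: (@continuous_comp _ _ _ x q); [exact: cx|exact: clamp_continuous].
  have ch : continuous h.
    move=> y; apply: (@cvgB _ _ _ (nbhs y)); last exact: affine_continuous.
    by apply: differentiable_continuous; have [+ _] := gC1; exact.
  have cF : {for t, continuous (fun t => f t (q (x t)))}.
    have cP : {for t, continuous (fun t => (t, q (x t)))}.
      move=> U [[P Q] [/= Pt Qx] PQU]; have Qt := cq _ Qx.
      by apply: filterS2 Pt Qt => s Ps Qs; apply: PQU.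
    apply: (@continuous_comp _ _ _ (fun t => (t, q (x t))) (fun z : R * 'rV[R]_2 => f z.1 z.2)) => //.
    by apply: differentiable_continuous; have [+ _] := fC1; exact.
  apply: (@cvgD _ _ _ (nbhs t)).
    by apply: (@continuous_comp _ _ _ (fun t => q (x t)) h); [exact: cq|exact: ch].
  by apply: (@cvgZ _ _ _ (nbhs t)); [exact: cvg_cst|exact: cF].
- by move=> l t x; rewrite pf.
- move=> l l' t x x'.
  rewrite opprD addrACA; apply: le_trans (ler_normD _ _) _.
  have -> : cl l *: f t (q x) - cl l' *: f t (q x') =
      cl l *: (f t (q x) - f t (q x')) + (cl l - cl l') *: f t (q x').
    by rewrite scalerBr scalerBl addrA subrK.
  have h1 := hlip _ _ (qr x) (qr x'); rewrite -/(h _) -/(h _) in h1.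
  have h2 := clamp_lip p x x' r; rewrite -/(q x) -/(q x') in h2.
  have h3 := fK t _ _ (qr x) (qr x').
  have h4 := fM t _ (qr x').
  have h5 := clampr_lip 0 l0 l l'; rewrite -/(cl l) -/(cl l') in h5.
  have [h6 h7] := andP (cl0 l).
  have n1 : `|cl l *: (f t (q x) - f t (q x'))| <= eps / 2 * `|x - x'|.
    rewrite normrZ ger0_norm //; apply: (@le_trans _ _ (l0 * (K * `|x - x'|))).
      apply: ler_pM => //; apply: le_trans h3 _; exact: ler_wpM2l.
    by rewrite mulrA ler_wpM2r.
  have n2 : `|(cl l - cl l') *: f t (q x')| <= M * `|l - l'|.
    by rewrite normrZ mulrC ler_pM.
  have n3 : `|h (q x) - h (q x')| <= eps / 2 * `|x - x'|.
    by apply: le_trans h1 _; rewrite ler_pM2l.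
  have n4 := ler_normD (cl l *: (f t (q x) - f t (q x'))) ((cl l - cl l') *: f t (q x')).
  lra.
- move=> l t x; apply: le_trans (ler_normD _ _) _; apply: lerD.
    have := hlip _ _ (qr x) pr; rewrite -/(h _) -/(h _) hp subr0 => H.
    by apply: le_trans H _; rewrite ler_pM2l.
  have [h6 h7] := andP (cl0 l).
  by rewrite normrZ ger0_norm // ler_pM //; exact: fM.
- split.
    by move=> t t' x; rewrite /cl clampr_id ?lexx ?ltW // !scale0r.
  by move=> l t x l01 xr; rewrite /q clamp_id // /cl clampr_id.
Unshelve. all: by end_near. Qed.

(** * Ejection from a singular zero *)

Lemma uniform_ball_nbhs (R : realType) n (h : {uniform R -> 'rV[R]_n}) (e : R) : 0 < e ->
  nbhs h [set k : {uniform R -> 'rV[R]_n} | forall t, `|(h : R -> 'rV[R]_n) t - (k : R -> 'rV[R]_n) t| < e].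
Proof.
move=> e0; apply/uniform_nbhs.
exists [set xy : 'rV[R]_n * 'rV[R]_n | ball xy.1 e xy.2]; split.
  exact: entourage_ball (PosNum e0).
by move=> k /= hk t; have := hk t I; rewrite -ball_normE.
Qed.

(** The topology of CT is induced by uniform convergence. *)
Lemma CT_continuous (R : realType) (T : R) (X : topologicalType) (Psi : X -> CT T) :
  (forall z (e : R), 0 < e -> \forall z' \near z,
     forall t, `|CT_fun (Psi z) t - CT_fun (Psi z') t| < e) -> continuous Psi.
Proof.
move=> H z U [_ [/= [W oW <-] Wz WU]].
have : nbhs (set_val (Psi z)) W by apply: open_nbhs_nbhs; split.
move/uniform_nbhs => [E []]; rewrite -entourage_ballE => -[e /= e0 eE] EW.
have := H z e e0; rewrite /fmapE /=; apply: filterS => z' zz'.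
apply: WU => /=; apply: EW => t _; apply: eE => /=.
by rewrite -ball_normE; exact: zz'.
Qed.

(** The zeros of G(l, a) = (a - p) A + c(l, a) near (0, p) give the T-pairs
    (l, a + u(l, a)).  Uniqueness in lyapunov_schmidt isolates p at l = 0, and
    continuation provides the connected set. *)
Lemma ejecting_of_singular (R : realType) (T : R)
    (g : 'rV[R]_2 -> 'rV[R]_2) (f : R -> 'rV[R]_2 -> 'rV[R]_2) (p : 'rV[R]_2) :
  0 < T -> C1 g -> C1 (fun z : R * 'rV[R]_2 => f z.1 z.2) ->
  (forall x, periodic (f ^~ x) T) -> isolated_zero g p -> zero_index g p != 0 ->
  \det ('J g p) = 0 -> ejecting_point (Tpairs g f) (CT_cst T p).
Proof.
move=> T0 gC1 fC1 pf [gp isop] indp detA; set A := 'J g p in detA.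
have cg : continuous g.
  by move=> x; apply: differentiable_continuous; have [+ _] := gC1; exact.
have [eps eps0 LS] := lyapunov_schmidt T0 detA.
have [r1 r10 iso] : exists2 r1 : R, 0 < r1 & forall y, `|y - p| <= r1 -> g y = 0 -> y = p.
  near (0 : R)^'+ => r1; exists r1 => //.
  by near: r1; exact: nbhs_closed_ball_le isop.
have [r [l0 [L [B [N [/andP[r0 rr1] l00 L0 [Nc Np Nl Nb [N0 NE]]]]]]]] :=
  localized_forcing T0 eps0 r10 gC1 fC1 pf gp.
have [u [c [K [uc us uK cK uniq]]]] := LS N L B L0 Nc Np Nl Nb.
(* constants need no correction at l = 0, where N does not depend on t *)
have u0 a : u 0 a = (fun=> 0) /\ c 0 a = N 0 0 a.
  have [] // := uniq 0 a (fun=> 0) (N 0 0 a).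
  split.
  - move=> i; apply: primitive_eq (primitive_cst ((0 : 'rV[R]_2) 0 i)) => t.
    by rewrite mul0mx add0r addr0 (N0 t 0) subrr mxE.
  - by [].
  - by move=> i; apply: balanced_eq (balanced0 T) => t; rewrite mxE.
split.
- move=> _ ->; split => //= t; rewrite /CT_fun /= gp scale0r addr0.
  exact: is_derive_cst.
(* a T-periodic solution that stays near p is its mean value plus a fixed
   point of the iteration, so it is constant *)
- pose Bl : set {uniform R -> 'rV[R]_2} :=
    [set k | forall t, `|(fun=> p) t - (k : R -> 'rV[R]_2) t| < r].
  have nB : nbhs ((fun=> p) : {uniform R -> 'rV[R]_2}) Bl by exact: uniform_ball_nbhs.
  exists (set_val @^-1` (Bl°)).
    by exists (Bl°) => //; exact: open_interior.
  apply/seteqP; split => [_ ->|y [/= [_ hy] /interior_subset By]].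
    split; last exact: nB.
    split => //= t; rewrite /CT_fun /= gp scale0r addr0.
    exact: is_derive_cst.
  pose x := CT_fun y.
  have [cx px] : continuous x /\ periodic x T by have := set_valP y.
  have xr t : `|x t - p| <= r by rewrite distrC ltW //; exact: By.
  have [a ba] := rv_exists_mean T0 cx px.
  have [v0 _] : (fun t => x t - a) = u 0 a /\ - ((a - p) *m A) = c 0 a.
    apply: uniq; split => //; last by move=> t; rewrite px.
    move=> i t; have := is_derive_coord i (hy t); rewrite /= scale0r addr0 => h.
    have := is_deriveB h (is_derive_cst (a 0 i) t 1); congr is_derive.
      by apply/funext => s; rewrite rvBE.
    have l0_ge0 : 0 <= (0 : R) <= l0 by rewrite lexx ltW.
    rewrite subr0 [a + _]addrC subrK opprK (NE 0 t (x t) l0_ge0 (xr t)) scale0r addr0.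
    suff -> : (x t - a) *m A + (g (x t) - (x t - p) *m A + (a - p) *m A) = g (x t) by [].
    by rewrite !mulmxBl; apply/rowP => j; rewrite !(rvBE, rvDE); ring.
  have xa t : x t = a.
    by have := congr1 (fun h => h t) v0; rewrite (u0 a).1 /= => /eqP; rewrite subr_eq0 => /eqP.
  have ap : a = p.
    apply: iso; first by rewrite -(xa 0) (le_trans (xr 0)).
    have [_ d1] := hy 0; have [_ d2] := is_derive_cst a (0:R) (1:R).
    have E : CT_fun y = cst a by apply/funext => t; exact: xa.
    by move: d1; rewrite E d2 scale0r addr0 => /esym.
  have : set_val y = (fun=> p) by apply/funext => t; rewrite -ap; exact: xa.
  by move=> yp; apply: val_inj.
pose K1 := `|K| + 1.
have K10 : 1 <= K1 by rewrite /K1 lerDr.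
have K1_gt0 : 0 < K1 by lra.
have KK1 x : 0 <= x -> K * x <= K1 * x.
  by move=> x0; rewrite ler_wpM2r // /K1; have := ler_norm K; lra.
(* on the ball of radius r2 and for l <= rho, the curve a + u stays within r of p:
   K1 (r2 + rho) <= r / 2 and r2 <= r / 4 *)
pose r2 := r / (4 * K1).
have r20 : 0 < r2 by rewrite divr_gt0 // mulr_gt0.
have K1r2 : K1 * r2 = r / 4 by rewrite /r2; field; rewrite gt_eqF.
have r2r : r2 <= r / 4 by rewrite -K1r2 ler_peMl // ltW.
pose rho := Num.min l0 r2.
have rho0 : 0 < rho by rewrite lt_min l00.
have [rhol rhor] : rho <= l0 /\ rho <= r2 by rewrite !ge_min !lexx orbT.
(* the parameter is rescaled to run through [0, 1] *)
pose F (z : R * 'rV[R]_2) := (z.2 - p) *m A + c (rho * z.1) z.2.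
have FE y : `|y - p| <= r -> F (0, y) = g y.
  have l0_ge0 : 0 <= (0 : R) <= l0 by rewrite lexx ltW.
  move=> yr; rewrite /F /= mulr0 (u0 y).2 (NE 0 0 y l0_ge0 yr) scale0r addr0.
  by rewrite addrCA subrr addr0.
have near_par (z : R * 'rV[R]_2) (e : R) : 0 < e ->
    \forall z' \near z, K1 * (`|z.2 - z'.2| + `|rho * z.1 - rho * z'.1|) < e.
  move=> e0.
  have d0 : 0 < e / (4 * K1) by rewrite divr_gt0 // mulr_gt0.
  have d1 : 0 < e / (4 * K1 * rho) by rewrite divr_gt0 // !mulr_gt0.
  have n2 : \forall z' \near z, `|z'.2 - z.2| < e / (4 * K1).
    have zz : `|z.2 - z.2| < e / (4 * K1) by rewrite subrr normr0.
    by have := near_ltball zz; exact: cvg_snd.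
  have n1 : \forall z' \near z, `|z'.1 - z.1| < e / (4 * K1 * rho).
    have zz : `|z.1 - z.1| < e / (4 * K1 * rho) by rewrite subrr normr0.
    by have := near_ltball zz; exact: cvg_fst.
  apply: filterS2 n1 n2 => z' h1 h2.
  rewrite -mulrBr normrM (gtr0_norm rho0) ![`|z.1 - _|]distrC ![`|z.2 - _|]distrC.
  rewrite ltr_pdivlMr ?mulr_gt0 // in h1; rewrite ltr_pdivlMr ?mulr_gt0 // in h2.
  lra.
have cF : continuous F.
  move=> z; apply: (@cvgD _ _ _ (nbhs z)).
    apply: (@continuous_comp _ _ _ (fun z : R * 'rV[R]_2 => z.2) (fun y => (y - p) *m A)).
      exact: cvg_snd.
    exact: affine_continuous.
  apply: (iffRL (@cvgrPdist_lt R 'rV[R]_2 _ (nbhs z) _ _ _)) => /= e e0.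
  apply: filterS (near_par z e e0) => z' h.
  apply: le_lt_trans h; apply: le_trans (cK _ _ _ _) _.
  by apply: KK1; rewrite addr_ge0.
have [M0 M00 HM] := zero_index_grid_degree cg indp.
pose M := M0 + `|p| + r2.
have MM0 : M0 <= M by rewrite /M; have := normr_ge0 p; lra.
have r2M : 0 < r2 <= M - `|p| by rewrite r20 /M /=; lra.
have iso2 y : `|y - p| <= r2 -> g y = 0 -> y = p.
  by move=> yr; apply: iso; lra.
have degg := HM M r2 MM0 r2M iso2.
have M_gt0 : 0 < M by lra.
have degF : \forall n \near \oo,
    grid_degree M n (fun y => F (0, y)) [set y | `|y - p| < r2] != 0.
  have cF0 : continuous (fun y => F (0, y)).
    move=> y; apply: (@continuous_comp _ _ _ (fun x : 'rV[R]_2 => (0 : R, x)) F).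
      exact: slice_continuous.
    exact: cF.
  have r2M' : r2 <= M - `|p| by case/andP: r2M.
  have Dgf : \forall n \near \oo,
      grid_degree M n g [set y | `|y - p| < r2] =
      grid_degree M n (fun y => F (0, y)) [set y | `|y - p| < r2].
    apply: grid_degree_straight => //; last exact: ball_border.
    move=> y t _ _ H; have [yr|yr] := leP `|y - p| r2; last by right; exact: near_gtball.
    left; apply: near_ltball; move: H; rewrite FE; last by lra.
    rewrite -scalerDl subrK scale1r => gy.
    by rewrite (iso2 y yr gy) subrr normr0.
  by apply: filterS2 degg Dgf => n gn <-.
have Fp : F (0, p) = 0 by rewrite FE ?gp // subrr normr0 ltW.
have isoF y : `|y - p| <= r2 -> F (0, y) = 0 -> y = p.
  by move=> yr; rewrite FE; [exact: iso2|lra].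
have [C [connC Cp CF [z1 Cz1 z10]]] := continuation cF r2M Fp isoF degF.
have CTx (z : R * 'rV[R]_2) : CT_set T
    ((fun t => z.2 + u (rho * z.1) z.2 t) : {uniform R -> 'rV[R]_2}).
  have [_ pu _] := us (rho * z.1) z.2; split => [t|t]; last by rewrite pu.
  by apply: (@cvgD _ _ _ (nbhs t)); [exact: cvg_cst|exact: uc].
pose x (z : R * 'rV[R]_2) : CT T := exist (fun x => x \in CT_set T) _ (mem_set (CTx z)).
have cx : continuous x.
  apply: CT_continuous => z e e0.
  have e2 : 0 < e / 2 by rewrite divr_gt0.
  apply: filterS (near_par z (e / 2) e2) => z' h t.
  have -> : CT_fun (x z) t - CT_fun (x z') t =
      (z.2 - z'.2) + (u (rho * z.1) z.2 t - u (rho * z'.1) z'.2 t).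
    by rewrite /CT_fun /= opprD addrACA.
  apply: le_lt_trans (ler_normD _ _) _.
  have h1 := uK (rho * z.1) z.2 (rho * z'.1) z'.2 t.
  have h2 : 0 <= `|z.2 - z'.2| + `|rho * z.1 - rho * z'.1| by rewrite addr_ge0.
  have h3 := KK1 _ h2.
  have h4 := ler_wpM2r h2 K10; rewrite mul1r in h4.
  have h5 := normr_ge0 (rho * z.1 - rho * z'.1).
  lra.
pose Psi (z : R * 'rV[R]_2) : R * CT T := (rho * z.1, x z).
have cPsi : continuous Psi.
  move=> z U [[P Q] [/= Pl Qx] PQU].
  have c1 : {for z, continuous (fun z : R * 'rV[R]_2 => rho * z.1)}.
    by apply: (@cvgM _ _ (nbhs z)); [exact: cvg_cst|exact: cvg_fst].
  have Pz : \forall z' \near z, P (rho * z'.1) by exact: (c1 _ Pl).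
  have Qz : \forall z' \near z, Q (x z') by exact: (cx z _ Qx).
  have PQz : \forall z' \near z, P (rho * z'.1) /\ Q (x z').
    by apply: filterS2 Pz Qz => z' Pz' Qz'; split.
  by apply: filterS PQz => z' Pz'; exact: PQU.
have PsiT z : C z -> Tpairs g f (Psi z).
  move=> /CF[/andP[z0 z1'] zr Fz].
  have lz : 0 <= rho * z.1 <= l0.
    apply/andP; split; first by apply: mulr_ge0 => //; exact: ltW.
    by apply: le_trans rhol; apply: ler_piMr => //; exact: ltW.
  split; first by case/andP: lz.
  move=> t /=; rewrite /CT_fun /=; set a := z.2; set l := rho * z.1.
  have ur : `|u l a t| <= r / 2.
    have := uK l a 0 p t; rewrite (u0 p).1 !subr0 => h.
    apply: le_trans h _.
    have lr : `|l| <= r2.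
      have [l0' _] := andP lz; rewrite ger0_norm //; apply: le_trans rhor.
      by apply: ler_piMr => //; exact: ltW.
    have h2 : `|a - p| + `|l| <= r2 + r2 by apply: lerD.
    have h3 : 0 <= `|a - p| + `|l| by rewrite addr_ge0.
    apply: le_trans (KK1 _ h3) _.
    have h4 : K1 * (`|a - p| + `|l|) <= K1 * (r2 + r2) by rewrite ler_pM2l.
    lra.
  have xr : `|a + u l a t - p| <= r.
    rewrite addrAC; apply: le_trans (ler_normD _ _) _.
    have zr' : `|a - p| <= r2 by exact: zr.
    lra.
  have [h _ _] := us l a.
  apply: is_derive_rV => i.
  have := primitiveD (primitive_cst (a 0 i)) (h i) t; congr is_derive.
    by apply/funext => s; rewrite rvDE.
  rewrite add0r (NE l t _ lz xr).
  have Fz' : (a - p) *m A + c l a = 0 by exact: Fz.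
  suff -> : u l a t *m A + (g (a + u l a t) - (a + u l a t - p) *m A + l *: f t (a + u l a t) - c l a)
     = g (a + u l a t) + l *: f t (a + u l a t) by [].
  rewrite (_ : a + u l a t - p = (a - p) + u l a t); last by rewrite addrAC.
  rewrite -[RHS]subr0 -Fz' mulmxDl.
  by apply/rowP => j; rewrite !(rvBE, rvDE); ring.
exists (Psi @` C); split.
- by apply: connected_continuous_connected => //; exact: continuous_subspaceT.
- by move=> _ [z Cz <-]; exact: PsiT.
- exists (Psi (0, p)); split; first by exists (0, p).
  split; first by rewrite /= mulr0.
  apply: val_inj => /=; apply/funext => t.
  by rewrite mulr0 (u0 p).1 addr0.
- move=> /(_ (Psi z1)) [|/= z10' _]; first by exists z1.
  by move/eqP: z10'; rewrite mulf_eq0 !gt_eqF.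
Unshelve. all: by end_near. Qed.

(** * The second-order criterion *)

Lemma second_diff00 (R : realType) (V W : normedModType R) (g : V -> W) (p : V) :
  second_diff g p 0 0 = 0.
Proof. by rewrite /second_diff linear0. Qed.

Lemma vec_integral0 (R : realType) n (a b : R) (F : R -> 'rV[R]_n) :
  (forall s, F s = 0) -> vec_integral a b F = 0.
Proof.
move=> F0; apply/rowP => i; rewrite !mxE /Rintegral.
by rewrite integral0_eq // => s _; rewrite F0 mxE.
Qed.

Lemma det_jacobian_eq0 (R : realType) n (g : 'rV[R]_n -> 'rV[R]_n) (p v : 'rV[R]_n) :
  v != 0 -> 'd g p v = 0 -> \det ('J g p) = 0.
Proof.
move=> v0 gv; apply/eqP; apply: contraNT v0 => /mulmx_eq0_det H.
by apply/eqP/H; rewrite -diffE_jacobian.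
Qed.

Theorem theorem4p12 (R : realType) (T : R)
    (g : 'rV[R]_2 -> 'rV[R]_2) (f : R -> 'rV[R]_2 -> 'rV[R]_2)
    (p0 : 'rV[R]_2)
    (T_gt0 : 0 < T)
    (g_C2 : C2 g)
    (f_C1 : C1 (fun z : R * 'rV[R]_2 => f z.1 z.2))
    (f_periodic : forall x, periodic (f ^~ x) T)
    (p0_isolated : isolated_zero g p0)
    (index_neq0 : zero_index g p0 != 0) :
  ((exists v : 'rV[R]_2, 'd g p0 v = 0 /\
      vec_integral 0 T (fun s =>
        second_diff g p0 v v *m expmx ((T - s) *: 'J g p0)) != 0) ->
    ejecting_point (Tpairs g f) (CT_cst T p0)) /\
  ((forall v : 'rV[R]_2, 'd g p0 v = 0) ->
    (exists v : 'rV[R]_2, second_diff g p0 v v != 0) ->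
    ejecting_point (Tpairs g f) (CT_cst T p0)).
Proof.
have main v : v != 0 -> 'd g p0 v = 0 -> ejecting_point (Tpairs g f) (CT_cst T p0).
  move=> v0 gv; apply: ejecting_of_singular => //; first by case: g_C2.
  exact: det_jacobian_eq0 gv.
split=> [[v [gv intv]]|dg0 [v gvv]]; apply: (main v) => //.
- apply: contraNneq intv => ->; rewrite vec_integral0 // => s.
  by rewrite second_diff00 mul0mx.
- by apply: contraNneq gvv => ->; rewrite second_diff00.
Qed.
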